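(* Let $E=(E^0,E^1,r,s)$ be a finite directed graph. Then the elements $S_e:=\psi(\chi_{Z(e)})$ ($e\in E^1$) and $P_v:=\pi(\chi_{Z(v)})$ ($v\in E^0$) of $\mathcal{T}(X(E^\infty))$ form a Toeplitz-Cuntz-Krieger $E$-family. The corresponding homomorphism $\pi_{S,P}$ of $\mathcal{T}C^*(E)$ into $\mathcal{T}(X(E^\infty))$ is injective, and, with $q:\mathcal{T}(X(E^\infty))\to\mathcal{O}(X(E^\infty))$ the quotient map, $q\circ\pi_{S,P}$ factors through an isomorphism of $C^*(E)$ onto $\mathcal{O}(X(E^\infty))$. Both the isomorphism $\pi_{S,P}$ of $\mathcal{T}C^*(E)$ onto its range and the isomorphism of $C^*(E)$ onto $\mathcal{O}(X(E^\infty))$ intertwine the respective gauge actions of $\mathbb{T}$.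
   Context: Graph conventions: a path is a sequence of edges $\mu=\mu_1\mu_2\cdots$ with $s(\mu_i)=r(\mu_{i+1})$. $E^\infty$ is the set of infinite paths $z=z_1z_2\cdots$, with $r(z):=r(z_1)$. The cylinder sets $Z(\mu)=\{z\in E^\infty:z_i=\mu_i\text{ for }i\le|\mu|\}$, for finite paths $\mu$ (with $Z(v)=\{z:r(z)=v\}$ for a vertex $v$), are a basis of compact open sets for a compact Hausdorff topology on $E^\infty$. The shift $\sigma(z)=z_2z_3\cdots$ is a local homeomorphism of $E^\infty$ into itself. $X(E^\infty)$ is the Hilbert bimodule over $C(E^\infty)$ with underlying space $C(E^\infty)$, actions $(a\cdot x\cdot b)(z)=a(z)x(z)b(\sigma(z))$ and inner product $\langle x,y\rangle(z)=\sum_{\sigma(w)=z}\overline{x(w)}y(w)$. For a Hilbert bimodule $X$ over a $C^*$-algebra $A$ (right Hilbert $A$-module with left action $\varphi:A\to\mathcal{L}(X)$), a representation $(\psi,\pi)$ is a linear map $\psi$ on $X$ and a homomorphism $\pi$ of $A$ into a $C^*$-algebra with $\psi(a\cdot x\cdot b)=\pi(a)\psi(x)\pi(b)$ and $\pi(\langle x,y\rangle)=\psi(x)^*\psi(y)$. The Toeplitz algebra $\mathcal{T}(X)$ is generated by a universal representation, denoted $(\psi,\pi)$. With $\Theta_{x,y}(z)=x\cdot\langle y,z\rangle$ and $\mathcal{K}(X)=\overline{\operatorname{span}}\{\Theta_{x,y}:x,y\in X\}$, there is a homomorphism $(\psi,\pi)^{(1)}:\mathcal{K}(X)\to\mathcal{T}(X)$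 with $\Theta_{x,y}\mapsto\psi(x)\psi(y)^*$; the Cuntz-Pimsner algebra $\mathcal{O}(X)$ is the quotient of $\mathcal{T}(X)$ by the ideal generated by $\{\pi(a)-(\psi,\pi)^{(1)}(\varphi(a)):a\in A,\ \varphi(a)\in\mathcal{K}(X)\}$. The gauge action on $\mathcal{T}(X)$ is given by $\gamma_z(\psi(x))=z\psi(x)$, $\gamma_z(\pi(a))=\pi(a)$, and induces one on $\mathcal{O}(X)$. A Toeplitz-Cuntz-Krieger $E$-family consists of mutually orthogonal projections $\{P_v:v\in E^0\}$ and partial isometries $\{S_e:e\in E^1\}$ in a $C^*$-algebra with $S_e^*S_e=P_{s(e)}$ for all $e$ and $P_v\ge\sum_{r(e)=v}S_eS_e^*$ for all $v$. It is a Cuntz-Krieger family if $P_v=\sum_{r(e)=v}S_eS_e^*$ whenever $r^{-1}(v)\neq\emptyset$. $\mathcal{T}C^*(E)$ and $C^*(E)$ are the $C^*$-algebras universal for Toeplitz-Cuntz-Krieger and Cuntz-Krieger families $(s,p)$ respectively; $C^*(E)$ is a quotient of $\mathcal{T}C^*(E)$. Their gauge actions satisfy $\gamma_z(s_e)=zs_e$, $\gamma_z(p_v)=p_v$. $\pi_{S,P}$ is the homomorphism with $s_e\mapsto S_e$, $p_v\mapsto P_v$.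
   Formalization: Injectivity of π_{S,P} and of the map C*(E)→O(X(E^∞)) is stated only for graphs in which every vertex receives an edge; if v receives none, Z(v) is empty and P_v=0 while p_v≠0, so both injectivity claims fail. *)

(* Defs.v *)
From HB Require Import structures.
From mathcomp Require Import all_boot all_order all_algebra.
From mathcomp Require Import complex ring.
From mathcomp Require Import all_classical all_reals all_analysis.

Set Implicit Arguments.
Unset Strict Implicit.
Unset Printing Implicit Defensive.

Import Order.TTheory GRing.Theory Num.Theory.
Import numFieldNormedType.Exports.

Local Open Scope classical_set_scope.
Local Open Scope ring_scope.

(* C*-algebras need not be unital, so they cannot extend the algebra structures
   of the library, which all have a 1. *)
HB.mixin Record CompleteNormedModule_isCStar (R : realType) A
    & CompleteNormedModule R[i] A := {
  cmul : A -> A -> A ;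
  star : A -> A ;
  cmulA : forall a b c, cmul a (cmul b c) = cmul (cmul a b) c ;
  cmul_linearl : forall b, linear (cmul^~ b) ;
  cmul_linearr : forall a, linear (cmul a) ;
  starK : forall a, star (star a) = a ;
  starM : forall a b, star (cmul a b) = cmul (star b) (star a) ;
  star_antilinear : forall (k : R[i]) a b,
    star (k *: a + b) = k^* *: star a + star b ;
  cnormM : forall a b, `|cmul a b| <= `|a| * `|b| ;
  cstar_identity : forall a, `|cmul (star a) a| = `|a| ^+ 2
}.

#[short(type="cstarType")]
HB.structure Definition CStarAlgebra (R : realType) :=
  { A of CompleteNormedModule R[i] A & CompleteNormedModule_isCStar R A }.

Reserved Notation "a ** b" (at level 40, left associativity).
Notation "a ** b" := (cmul a b) : ring_scope.

Section Complex.
Variable R : realType.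
Implicit Types (z w : R[i]).

Lemma norm_RRe z : (complex.Re `|z|)%:C%C = `|z|.
Proof. by rewrite RRe_real// normr_real. Qed.

Lemma normc_le_ReIm z :
  `|z| <= (`|complex.Re z| + `|complex.Im z|)%:C%C.
Proof.
rewrite {1}[z]complexE (le_trans (ler_normD _ _))// normrM.
have nR (x : R) : `|x%:C%C| = (`|x|)%:C%C :> R[i].
  by rewrite normc_def /= expr0n /= addr0 sqrtr_sqr.
by rewrite !nR normc_def /= expr0n /= add0r expr1n sqrtr1 mul1r rmorphD.
Qed.

Lemma complex_complete (F : set_system R[i]^o) :
  ProperFilter F -> cauchy F -> cvg F.
Proof.
move=> FF /cauchyP Fc.
have cpart (g : R[i] -> R) : (forall z w, (`|g z - g w|)%:C%C <= `|z - w|) ->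
    cvg (g @ F).
  move=> gle; apply: R_complete; apply/cauchyP => e e0.
  have e0' : 0 < e%:C%C :> R[i] by rewrite ltcR.
  have [z Fz] := Fc _ e0'.
  exists (g z); change (F (g @^-1` ball (g z) e)).
  apply: (filterS _ Fz) => w zw.
  by rewrite /ball /= -ltcR; apply: le_lt_trans (gle _ _) _.
have /cvg_ex[a Ha] : cvg (@complex.Re R @ F).
  apply: cpart => z w; rewrite -raddfB; exact: normc_ge_Re.
have /cvg_ex[b Hb] : cvg (@complex.Im R @ F).
  apply: cpart => z w; rewrite -raddfB -normrN -ReiNIm.
  apply: le_trans (normc_ge_Re _) _.
  by rewrite normrM normCi mulr1.
apply/cvg_ex; exists (Complex a b); apply/cvgrPdist_lt => e e0.
have re0 : 0 < complex.Re e / 2.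
  by rewrite divr_gt0//; move: e0; rewrite ltcE => /andP[].
have eE : e = (complex.Re e)%:C%C by rewrite RRe_real// gtr0_real.
move/cvgrPdist_lt: Ha => /(_ _ re0) Ha.
move/cvgrPdist_lt: Hb => /(_ _ re0) Hb.
near=> z.
apply: le_lt_trans (normc_le_ReIm _) _.
rewrite eE ltcR [ltRHS]splitr ltrD// ?raddfB /=.
  by near: z; exact: Ha.
by near: z; exact: Hb.
Unshelve. all: by end_near. Qed.

End Complex.

Definition contfun (R : realType) (X : topologicalType)
  of compact [set: X] : Type := continuousType X R[i]^o.

Section ContinuousFunctions.
Variables (R : realType) (X : topologicalType) (cX : compact [set: X]).
Local Notation C := R[i]^o.
Local Notation CX := (contfun R cX).
Implicit Types f g h : CX.

HB.instance Definition _ := Choice.on CX.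

Definition contfun_of (f : X -> C) (cf : continuous f) : CX := mkcts cf.

Lemma contfunP f g : (forall x, f x = g x) -> f = g.
Proof. by move=> fg; apply/continuousEP. Qed.

Lemma contfun_cts f : continuous (f : X -> C).
Proof. exact: cts_fun. Qed.

Lemma cf0_cts : continuous (fun _ : X => 0 : C).
Proof. exact: cst_continuous. Qed.
Lemma cfD_cts f g : continuous (fun x => f x + g x : C).
Proof. by move=> x; exact: (cvgD (@contfun_cts f x) (@contfun_cts g x)). Qed.
Lemma cfN_cts f : continuous (fun x => - f x : C).
Proof. by move=> x; exact: (cvgN (@contfun_cts f x)). Qed.
Lemma cfZ_cts (k : R[i]) f : continuous (fun x => k * f x : C).
Proof. by move=> x; exact: (cvgZl_tmp (@contfun_cts f x)). Qed.
Lemma cfM_cts f g : continuous (fun x => f x * g x : C).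
Proof. by move=> x; exact: (cvgM (@contfun_cts f x) (@contfun_cts g x)). Qed.
Lemma cfJ_cts f : continuous (fun x => (f x)^* : C).
Proof.
move=> x; apply/cvgrPdist_lt => e e0.
have /cvgrPdist_lt/(_ _ e0) := @contfun_cts f x; apply: filterS => y.
by rewrite -rmorphB norm_conjC.
Qed.

Definition cf0 := contfun_of cf0_cts.
Definition cfD f g := contfun_of (@cfD_cts f g).
Definition cfN f := contfun_of (@cfN_cts f).
Definition cfZ k f := contfun_of (@cfZ_cts k f).
Definition cfM f g := contfun_of (@cfM_cts f g).
Definition cfJ f := contfun_of (@cfJ_cts f).

Lemma cfDA : associative cfD.
Proof. by move=> f g h; apply: contfunP => x; exact: addrA. Qed.
Lemma cfDC : commutative cfD.
Proof. by move=> f g; apply: contfunP => x; exact: addrC. Qed.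
Lemma cf0D : left_id cf0 cfD.
Proof. by move=> f; apply: contfunP => x; exact: add0r. Qed.
Lemma cfND : left_inverse cf0 cfN cfD.
Proof. by move=> f; apply: contfunP => x; exact: addNr. Qed.

HB.instance Definition _ := GRing.isZmodule.Build CX cfDA cfDC cf0D cfND.

Lemma cfZA a b f : cfZ a (cfZ b f) = cfZ (a * b) f.
Proof. by apply: contfunP => x; exact: mulrA. Qed.
Lemma cf1Z : left_id 1 cfZ.
Proof. by move=> f; apply: contfunP => x; exact: mul1r. Qed.
Lemma cfZDr : right_distributive cfZ +%R.
Proof. by move=> a f g; apply: contfunP => x; exact: mulrDr. Qed.
Lemma cfZDl f : {morph cfZ^~ f : a b / a + b}.
Proof. by move=> a b; apply: contfunP => x; exact: mulrDl. Qed.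

HB.instance Definition _ :=
  GRing.Zmodule_isLmodule.Build R[i] CX cfZA cf1Z cfZDr cfZDl.

Definition cfnorm f : R[i] :=
  (sup [set complex.Re `|f x| | x in [set: X]])%:C%C.

Lemma cf_has_ubound f : has_ubound [set complex.Re `|f x| | x in [set: X]].
Proof.
have cRe : continuous (fun x => complex.Re `|f x| : R).
  move=> x; apply/cvgrPdist_lt => e e0.
  have e0' : 0 < e%:C%C :> R[i] by rewrite ltcR.
  have /cvgrPdist_lt/(_ _ e0') := @contfun_cts f x; apply: filterS => y.
  move=> xy; rewrite -ltcR; apply: le_lt_trans xy.
  rewrite -raddfB; apply: le_trans (normc_ge_Re _) _.
  exact: ler_dist_dist.
have /compact_bounded[M [_ HM]] :
    compact [set complex.Re `|f x| | x in [set: X]].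
  by apply: continuous_compact => //; apply: continuous_subspaceT.
exists (M + 1) => _ [x _ <-].
apply: le_trans (ler_norm _) _; apply: HM; last by exists x.
by rewrite ltrDl.
Qed.

Lemma cfnorm_ge f x : `|f x| <= cfnorm f.
Proof.
rewrite -norm_RRe lecR; apply: ub_le_sup; last by exists x.
exact: cf_has_ubound.
Qed.

Lemma cfnorm_le f (M : R[i]) :
  0 <= M -> (forall x, `|f x| <= M) -> cfnorm f <= M.
Proof.
move=> M0 fM; rewrite -[M]RRe_real ?ger0_real// lecR.
have [->|ne] := eqVneq [set complex.Re `|f x| | x in [set: X]] set0.
  by rewrite sup0; move: M0; rewrite lecE => /andP[].
apply: ge_sup; first exact/set0P.
by move=> _ [x _ <-]; have := fM x; rewrite lecE => /andP[].
Qed.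

Lemma cfnorm_ge0 f : 0 <= cfnorm f.
Proof.
have [[x _]|X0] := pselect (exists x : X, True).
  by apply: le_trans (cfnorm_ge f x).
rewrite /cfnorm (_ : [set _ | _ in _] = set0) ?sup0//.
by apply/seteqP; split=> // y [x _ _]; case: X0; exists x.
Qed.

Lemma cfnormD f g : cfnorm (f + g) <= cfnorm f + cfnorm g.
Proof.
apply: cfnorm_le => [|x]; first by rewrite addr_ge0// cfnorm_ge0.
by apply: le_trans (ler_normD _ _) _; apply: lerD; apply: cfnorm_ge.
Qed.

Lemma cfnormZ (k : R[i]) f : cfnorm (k *: f) = `|k| * cfnorm f.
Proof.
have le1 (l : R[i]) g : cfnorm (l *: g) <= `|l| * cfnorm g.
  apply: cfnorm_le => [|x]; first by rewrite mulr_ge0// cfnorm_ge0.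
  by rewrite [leLHS]normrM ler_wpM2l// cfnorm_ge.
apply/eqP; rewrite eq_le le1/=.
have [->|k0] := eqVneq k 0.
  by rewrite normr0 mul0r cfnorm_ge0.
rewrite -ler_pdivlMl ?normr_gt0// -normfV.
by rewrite -{1}[f](scalerK k0)// le1.
Qed.

Lemma cfnorm0_eq0 f : cfnorm f = 0 -> f = 0.
Proof.
move=> f0; apply: contfunP => x; apply/eqP.
by rewrite -normr_le0 -f0 cfnorm_ge.
Qed.

HB.instance Definition _ :=
  Lmodule_isNormed.Build R[i] CX cfnormD cfnormZ cfnorm0_eq0.

Lemma contfun_complete (F : set_system CX) :
  ProperFilter F -> cauchy F -> cvg F.
Proof.
move=> FF /cauchyP Fc.
have evc x : cvg ((fun f : CX => f x : C) @ F).
  apply: complex_complete; apply/cauchyP => e e0.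
  have [f Ff] := Fc _ e0.
  exists (f x); change (F ((fun g : CX => g x : C) @^-1` ball (f x : C) e)).
  apply: (filterS _ Ff) => g fg.
  by rewrite /ball /=; apply: le_lt_trans fg; exact: (cfnorm_ge (f - g) x).
pose l x : C := lim ((fun f : CX => f x : C) @ F).
have Hl e : 0 < e -> exists2 f, F (ball f e) & forall x, `|l x - f x| <= e.
  move=> e0; have [f Ff] := Fc _ e0; exists f => // x.
  apply/ler_addgt0Pr => d d0.
  have /cvgrPdist_lt/(_ _ d0) Fd : (fun f : CX => f x : C) @ F --> l x.
    exact: evc.
  have [g [/= gd gf]] := filter_ex (filterI Fd Ff).
  rewrite [leRHS]addrC; apply: le_trans (ler_distD (g x) _ _) _.
  apply: lerD; first exact: ltW.
  rewrite distrC; apply: ltW; apply: le_lt_trans gf.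
  exact: (cfnorm_ge (f - g) x).
have lc : continuous l.
  move=> x; apply/cvgrPdist_lt => e e0.
  have e30 : 0 < e / 3 by rewrite divr_gt0.
  have [f _ fl] := Hl _ e30.
  have /cvgrPdist_lt/(_ _ e30) := @contfun_cts f x; apply: filterS => y xy.
  have -> : e = e / 3 + (e / 3 + e / 3) by field.
  apply: le_lt_trans (ler_distD (f x) _ _) _; apply: ler_ltD; first exact: fl.
  apply: le_lt_trans (ler_distD (f y) _ _) _; apply: ltr_leD; first exact: xy.
  by rewrite distrC; exact: fl.
apply/cvg_ex; exists (contfun_of lc); apply/cvgrPdist_le => e e0.
have e20 : 0 < e / 2 by rewrite divr_gt0.
have [f Ff fl] := Hl _ e20.
apply: (filterS _ Ff) => g fg; apply: cfnorm_le; first exact: ltW.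
move=> x; rewrite [e]splitr.
apply: le_trans (ler_distD (f x) _ _) _; apply: lerD; first exact: fl.
by apply: ltW; apply: le_lt_trans fg; exact: (cfnorm_ge (f - g) x).
Qed.

HB.instance Definition _ := Uniform_isComplete.Build CX contfun_complete.

Lemma cfMA f g h : cfM f (cfM g h) = cfM (cfM f g) h.
Proof. by apply: contfunP => x; exact: mulrA. Qed.
Lemma cfJK f : cfJ (cfJ f) = f.
Proof. by apply: contfunP => x; exact: conjCK. Qed.
Lemma cfM_linearl g : linear (cfM^~ g).
Proof.
move=> k f h; apply: contfunP => x.
by rewrite /= [LHS]mulrDl -mulrA.
Qed.
Lemma cfM_linearr f : linear (cfM f).
Proof.
move=> k g h; apply: contfunP => x.
by rewrite /= [LHS]mulrDr mulrCA.
Qed.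
Lemma cfJ_antilinear (k : R[i]) f g : cfJ (k *: f + g) = k^* *: cfJ f + cfJ g.
Proof. by apply: contfunP => x; rewrite /= [LHS]rmorphD [X in X + _]rmorphM. Qed.
Lemma cfJM f g : cfJ (cfM f g) = cfM (cfJ g) (cfJ f).
Proof. by apply: contfunP => x; rewrite /= [LHS]rmorphM [LHS]mulrC. Qed.
Lemma cfnormM f g : `|cfM f g| <= `|f| * `|g|.
Proof.
apply: cfnorm_le => [|x]; first by rewrite mulr_ge0.
by rewrite [leLHS]normrM ler_pM// cfnorm_ge.
Qed.
Lemma cfnormJM f : `|cfM (cfJ f) f| = `|f| ^+ 2.
Proof.
apply/eqP; rewrite eq_le; apply/andP; split.
  apply: cfnorm_le => [|x]; first by rewrite exprn_ge0.
  rewrite [leLHS]normrM norm_conjC -expr2 lerXn2r ?nnegrE//.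
  exact: (cfnorm_ge f x).
rewrite -[leRHS]sqrtCK lerXn2r ?nnegrE ?sqrtC_ge0//.
apply: cfnorm_le => [|x]; first by rewrite sqrtC_ge0.
rewrite -[leLHS](@sqrCK _ `|f x|)// ler_sqrtC ?nnegrE ?exprn_ge0//.
apply: le_trans (cfnorm_ge (cfM (cfJ f) f) x).
by rewrite [leRHS]normrM norm_conjC expr2.
Qed.

HB.instance Definition _ := CompleteNormedModule_isCStar.Build R CX
  cfMA cfM_linearl cfM_linearr cfJK
  cfJM
  cfJ_antilinear cfnormM cfnormJM.

End ContinuousFunctions.

Record digraph := Digraph {
  vertex : finType ;
  edge : finType ;
  rng : edge -> vertex ;
  src : edge -> vertex
}.

(* At a vertex v with no infinite path ending there, Z(v) is empty and P_v is 0,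
   although the universal p_v is not; excluding sources excludes this. *)
Definition no_sources (E : digraph) :=
  forall v : vertex E, exists e : edge E, rng e = v.

(* Indices start at 0: the edge written z_i in 1-based notation is z (i - 1). *)
Record infpath (E : digraph) := InfPath {
  ip_edge :> nat -> edge E ;
  infpathP : forall i, src (ip_edge i) = rng (ip_edge i.+1)
}.

Section PathSpace.
Variable E : digraph.
Implicit Types (z w : infpath E) (v : vertex E) (mu : seq (edge E)).

Definition infpath_rng z := rng (z 0%N).

Definition finpath mu := sorted (fun e f => src e == rng f) mu.

Definition vcyl v : set (infpath E) := [set z | infpath_rng z = v].
Definition cyl mu : set (infpath E) := [set z | mkseq z (size mu) = mu].

Definition cylinders : set (set (infpath E)) :=
  [set A | (exists v, A = vcyl v) \/
           (exists mu, [/\ mu != [::], finpath mu & A = cyl mu])].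

Lemma infpath_eq z w : (forall i, z i = w i) -> z = w.
Proof.
case: z w => [z zP] [w wP] /= zw.
have {}zw : z = w by apply/funext.
by move: wP; rewrite -zw => wP; congr InfPath; exact: Prop_irrelevance.
Qed.

HB.instance Definition _ := gen_eqMixin (infpath E).
HB.instance Definition _ := gen_choiceMixin (infpath E).

Definition agree n z w := forall i, (i < n)%N -> w i = z i.

Lemma cyl_agree n z w : cyl (mkseq z n) w <-> agree n z w.
Proof.
rewrite /cyl /= size_mkseq; split=> [wz i ni|wz].
  by have := congr1 (fun s => nth (w i) s i) wz; rewrite !nth_mkseq.
apply: (@eq_from_nth _ (w 0%N)) => [|i]; first by rewrite !size_mkseq.
by rewrite size_mkseq => ni; rewrite !nth_mkseq// wz.
Qed.

Lemma cylinders_agree A z : cylinders A -> A z ->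
  exists n, forall m w, (n <= m)%N -> agree m z w -> A w.
Proof.
case=> [[v ->] zv|[mu [mu0 muP ->]] zmu].
  by exists 1%N => m w m1 zw; rewrite /vcyl /infpath_rng /= zw.
exists (size mu) => m w le zw; rewrite -[mu]zmu.
by apply/cyl_agree => i ilt; apply: zw; apply: leq_trans le.
Qed.

Lemma cylinders_mkseq n z : cylinders (cyl (mkseq z n.+1)).
Proof.
right; exists (mkseq z n.+1); split => //.
apply/(sortedP (z 0%N)) => i; rewrite size_mkseq => ilt.
rewrite !nth_mkseq//; first exact/eqP/infpathP.
exact: ltnW.
Qed.

Lemma cylinders_cover : \bigcup_(A in cylinders) A = [set: infpath E].
Proof.
apply/seteqP; split=> // z _; exists (vcyl (infpath_rng z)) => //.
by left; exists (infpath_rng z).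
Qed.

Lemma cylinders_join A B z : cylinders A -> cylinders B -> A z -> B z ->
  exists C, [/\ cylinders C, C z & C `<=` A `&` B].
Proof.
move=> cA cB Az Bz.
have [n An] := cylinders_agree cA Az.
have [m Bm] := cylinders_agree cB Bz.
exists (cyl (mkseq z (maxn n m).+1)); split; first exact: cylinders_mkseq.
  by apply/cyl_agree.
move=> w /cyl_agree zw; split.
  by apply: An zw; rewrite leqW// leq_maxl.
by apply: Bm zw; rewrite leqW// leq_maxr.
Qed.

HB.instance Definition _ :=
  isBaseTopological.Build (infpath E) cylinders_cover cylinders_join.

Lemma nbhs_agreeP z (A : set (infpath E)) :
  nbhs z A <-> exists n, forall w, agree n z w -> A w.
Proof.
rewrite nbhsE; split=> [[B [[D DC <-] [C DC' Cz]] BA]|[n nA]].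
  have [n Cn] := cylinders_agree (DC _ DC') Cz.
  by exists n => w zw; apply: BA; exists C => //; apply: Cn zw.
exists (cyl (mkseq z n.+1)).
  split; last by apply/cyl_agree.
  exists [set (cyl (mkseq z n.+1))].
    by move=> _ ->; exact: cylinders_mkseq.
  by rewrite bigcup_set1.
by move=> w /cyl_agree zw; apply: nA => i ni; apply: zw; exact: leqW.
Qed.

Lemma infpath_compact : compact [set: infpath E].
Proof.
move=> F FF _.
pose big (A : set (infpath E)) := ~ F (~` A).
have bigU (I : finType) (A : I -> set (infpath E)) (B : set (infpath E)) :
    big B -> B `<=` \bigcup_(i in [set: I]) A i -> exists i, big (A i).
  move=> bB BA; apply: contrapT => nA; apply: bB.
  have FA i : F (~` A i).
    by apply: contrapT => nF; apply: nA; exists i.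
  have FF' : Filter F by exact: filter_filter.
  have FA' := @filter_forall _ I (fun i => ~` A i) F FF' FA.
  apply: (@filterS _ F FF' _ _ _ FA') => z Az Bz.
  by have [i _ Ai] := BA _ Bz; exact: Az Ai.
have big0 A : big A -> A !=set0.
  move=> bA; apply/set0P/eqP => A0; apply: bA; rewrite A0 setC0.
  exact: filterT.
have step (mu : {mu | big (cyl mu)}) :
    {e | big (cyl (rcons (projT1 mu) e))}.
  apply: cid; case: mu => mu /= bmu.
  apply: bigU bmu _ => z zmu; exists (z (size mu)) => //.
  by rewrite /cyl /= size_rcons mkseqS zmu.
have b0 : big (cyl [::]).
  rewrite /big (_ : ~` _ = set0); first exact: filter_not_empty.
  by apply/seteqP; split=> // z; apply.
pose st (mu : {mu | big (cyl mu)}) : {mu | big (cyl mu)} :=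
  exist _ (rcons (projT1 mu) (projT1 (step mu))) (projT2 (step mu)).
pose mu n := iter n st (exist _ [::] b0).
pose ze n := projT1 (step (mu n)).
have muE n : projT1 (mu n) = mkseq ze n.
  by elim: n => // n IH; rewrite mkseqS -IH.
have bze n : big (cyl (mkseq ze n)) by rewrite -muE; exact: projT2 (mu n).
have zeP i : src (ze i) = rng (ze i.+1).
  have [w wi] := big0 _ (bze i.+2).
  have wz : mkseq w (size (mkseq ze i.+2)) = mkseq ze i.+2 := wi.
  rewrite size_mkseq in wz.
  have wE k : (k < i.+2)%N -> w k = ze k.
    by move=> ki; have := congr1 (fun s => nth (ze k) s k) wz;
      rewrite !nth_mkseq.
  by rewrite -!wE//; exact: infpathP.
exists (InfPath zeP); split => // A B FA /nbhs_agreeP[n nB].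
have /contrapT : ~ ~ (A `&` cyl (mkseq ze n) !=set0).
  move=> A0; apply: (bze n); apply: (filterS _ FA) => z Az zn; apply: A0.
  by exists z.
case=> z [Az zn]; exists z; split=> //; apply: nB.
exact/(cyl_agree n (InfPath zeP)).
Qed.

Definition shift z : infpath E :=
  InfPath (fun i => infpathP z i.+1).

Definition prepend_edges (e : edge E) z i := if i is j.+1 then z j else e.

Lemma prepend_infpathP (e : edge E) z : src e = infpath_rng z ->
  forall i, src (prepend_edges e z i) = rng (prepend_edges e z i.+1).
Proof. by move=> ez [|i] //=; exact: infpathP. Qed.

(* The path e z; junk value z when e and z are not composable. *)
Definition prepend (e : edge E) z : infpath E :=
  if pselect (src e = infpath_rng z) is left ez
  then InfPath (prepend_infpathP ez) else z.

Lemma prependE e z : src e = infpath_rng z ->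
  forall i, prepend e z i = prepend_edges e z i.
Proof. by rewrite /prepend; case: pselect. Qed.

Lemma shift_prepend e z : src e = infpath_rng z -> shift (prepend e z) = z.
Proof. by move=> ez; apply: infpath_eq => i /=; rewrite prependE. Qed.

Lemma prepend_shift z : prepend (z 0%N) (shift z) = z.
Proof.
have e0 : src (z 0%N) = infpath_rng (shift z) by exact: infpathP.
by apply: infpath_eq => -[|i]; rewrite prependE.
Qed.

Lemma shift_continuous : continuous shift.
Proof.
move=> z A /nbhs_agreeP[n nA]; apply/nbhs_agreeP; exists n.+1 => w zw.
by apply: nA => i ni /=; exact: zw.
Qed.

Lemma prepend_continuous e : continuous (prepend e).
Proof.
move=> z A /nbhs_agreeP[n nA]; apply/nbhs_agreeP; exists n.+1 => w zw.
apply: nA => i ni.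
have rE : infpath_rng w = infpath_rng z by rewrite /infpath_rng zw.
rewrite /prepend; case: pselect => [ew|ew]; case: pselect => [ez|ez] /=.
- by case: i ni => //= i ni; apply: zw; apply: ltnW; exact: ltnW.
- by case: ez; rewrite -rE.
- by case: ew; rewrite rE.
- by apply: zw; exact: ltnW.
Qed.

Lemma shift_fiber z :
  [set w | shift w = z] = prepend^~ z @` [set e | src e = infpath_rng z].
Proof.
apply/seteqP; split=> [w <-|_ [e ez <-]]; last exact: shift_prepend.
by exists (w 0%N); [exact: infpathP|exact: prepend_shift].
Qed.

Lemma fsum_fiber (V : nmodType) (F : infpath E -> V) z :
  \sum_(w \in [set w | shift w = z]) F w =
  \sum_(e : edge E | src e == infpath_rng z) F (prepend e z).
Proof.
rewrite shift_fiber fsbig_image; last first.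
  move=> e f /set_mem ez /set_mem fz ef.
  have := congr1 (fun w : infpath E => w 0%N) ef.
  by rewrite (prependE ez) (prependE fz).
rewrite (_ : [set e | _] = [set` [pred e | src e == infpath_rng z]]).
  rewrite -(@bigfs _ _ _ _ (index_enum (edge E))) ?index_enum_uniq// => e _.
  by rewrite mem_index_enum.
by apply/seteqP; split=> e /eqP.
Qed.

Definition indic_fun (R : realType) (A : set (infpath E)) z : R[i]^o :=
  (`[<A z>])%:R.

Lemma indic_continuous (R : realType) A :
  cylinders A -> continuous (indic_fun R A).
Proof.
move=> cA z B Bz; apply/nbhs_agreeP.
suff [n nA] : exists n, forall w, agree n z w -> (A w <-> A z).
  exists n => w zw; rewrite /= /indic_fun.
  by rewrite (asbool_equiv_eq (nA _ zw)); exact: nbhs_singleton Bz.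
case: cA => [[v ->]|[mu [_ _ ->]]].
  by exists 1%N => w zw; rewrite /vcyl /infpath_rng /= zw.
exists (size mu) => w zw; rewrite /cyl /=.
by rewrite (_ : mkseq w _ = mkseq z (size mu))//; apply/eq_in_map => i;
  rewrite mem_iota => /andP[_ ilt]; exact: zw.
Qed.

End PathSpace.

Definition C_infpath (R : realType) (E : digraph) : cstarType R :=
  contfun R (@infpath_compact E).

Definition chi (R : realType) (E : digraph) (A : set (infpath E))
    (cA : cylinders A) : C_infpath R E :=
  contfun_of (@infpath_compact E) (@indic_continuous E R A cA).

Lemma cylinders_vertex (E : digraph) (v : vertex E) : cylinders (vcyl v).
Proof. by left; exists v. Qed.

Lemma cylinders_edge (E : digraph) (e : edge E) : cylinders (cyl [:: e]).
Proof. by right; exists [:: e]. Qed.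

Definition bimod_norm (R : realType) (A : cstarType R) (X : Type)
  (ip : X -> X -> A) (x : X) : R[i] := sqrtC `|ip x x|.

Definition cpos (R : realType) (A : cstarType R) (a : A) :=
  exists c : A, a = star c ** c.

Definition cle (R : realType) (A : cstarType R) (a b : A) := cpos (b - a).

(* A right Hilbert A-module, complete for the norm x |-> `|<x, x>|^(1/2), with
   a homomorphism of A into its adjointable operators as left action. *)
Record hilbert_bimodule (R : realType) (A : cstarType R) := HilbertBimodule {
  hb_sort :> lmodType R[i] ;
  lact : A -> hb_sort -> hb_sort ;
  ract : hb_sort -> A -> hb_sort ;
  hip : hb_sort -> hb_sort -> A ;
  ract_linearl : forall a, linear (ract^~ a) ;
  ract_linearr : forall x, linear (ract x) ;
  ractM : forall x a b, ract x (a ** b) = ract (ract x a) b ;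
  hip_linearr : forall x, linear (hip x) ;
  hip_ract : forall x y a, hip x (ract y a) = hip x y ** a ;
  star_hip : forall x y, star (hip x y) = hip y x ;
  hip_ge0 : forall x, cpos (hip x x) ;
  hip_eq0 : forall x, hip x x = 0 -> x = 0 ;
  hb_complete : forall u : nat -> hb_sort,
    (forall e : R[i], 0 < e -> exists N, forall m n, (N <= m)%N -> (N <= n)%N ->
       bimod_norm hip (u m - u n) < e) ->
    exists x, forall e : R[i], 0 < e -> exists N, forall n, (N <= n)%N ->
       bimod_norm hip (u n - x) < e ;
  lact_linearl : forall x, linear (lact^~ x) ;
  lactM : forall a b x, lact (a ** b) x = lact a (lact b x) ;
  lact_adjoint : forall a x y, hip (lact a x) y = hip x (lact (star a) y)
}.

Lemma continuous_near_eq (X Y : topologicalType) (f g : X -> Y) (x : X) :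
  {for x, continuous g} -> (\forall y \near x, f y = g y) ->
  {for x, continuous f}.
Proof.
move=> cg fg A; rewrite /= (nbhs_singleton fg) => /cg gA.
change (nbhs x (f @^-1` A)).
have {}gA : nbhs x (g @^-1` A) := gA.
apply: (filterS _ (filterI gA fg)) => y [Ay fgy].
by rewrite /preimage /= fgy.
Qed.

Lemma continuous_sum (R : realType) (X : topologicalType) (I : finType)
    (P : pred I) (f : I -> X -> R[i]^o) :
  (forall i, P i -> continuous (f i)) ->
  continuous (fun x => \sum_(i | P i) f i x : R[i]^o).
Proof.
move=> cf x; apply: (@cvg_big R[i]^o I +%R 0 P _ X (nbhs x) (index_enum I)
  f (f^~ x) _ (fun i Pi => cf i Pi x)); exact: add_continuous.
Qed.

Lemma contfun_ge0_cpos (R : realType) (X : topologicalType)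
    (cX : compact [set: X]) (f : contfun R cX) :
  (forall x, 0 <= (f : continuousType X R[i]^o) x) -> cpos f.
Proof.
move=> f0; pose fx x : R[i] := (f : continuousType X R[i]^o) x.
have fE x : fx x = (complex.Re (fx x))%:C%C.
  by rewrite RRe_real// ger0_real//; exact: f0.
pose s x : R[i]^o := (Num.sqrt (complex.Re (fx x)))%:C%C.
have RN (r : R) : `|r%:C%C| = (`|r|)%:C%C :> R[i].
  by rewrite normc_def /= expr0n /= addr0 sqrtr_sqr.
have Re_cts : continuous (fun x => complex.Re (fx x) : R).
  move=> x; apply/cvgrPdist_lt => e e0.
  have e0' : 0 < e%:C%C :> R[i] by rewrite ltcR.
  have /cvgrPdist_lt/(_ _ e0') := @contfun_cts R X cX f x.
  apply: filterS => y xy; rewrite -ltcR; apply: le_lt_trans xy.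
  by rewrite -raddfB; exact: normc_ge_Re.
have s_cts : continuous s.
  move=> x; apply/cvgrPdist_lt => e e0.
  have eE : e = (complex.Re e)%:C%C by rewrite RRe_real// gtr0_real.
  have re0 : 0 < complex.Re e by move: e0; rewrite eE ltcR.
  have : {for x, continuous (Num.sqrt \o (fun x => complex.Re (fx x)))}.
    exact: (continuous_comp (@Re_cts x) (@sqrt_continuous R _)).
  move=> /cvgrPdist_lt/(_ _ re0); apply: filterS => y xy.
  by rewrite eE /s -rmorphB RN ltcR.
exists (contfun_of cX s_cts); apply: contfunP => x.
change (fx x = (s x)^* * s x); rewrite conj_Creal; last first.
  by apply/complex_realP; exists (Num.sqrt (complex.Re (fx x))).
rewrite /s -rmorphM -expr2 sqr_sqrtr -?fE//.
by have := f0 x; rewrite -/(fx x) fE ler0c.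
Qed.

Section PathBimodule.
Variables (R : realType) (E : digraph).
Local Notation C := R[i]^o.
Local Notation CE := (C_infpath R E).
Implicit Types (a b x y : CE) (z w : infpath E).

Definition mkC (f : infpath E -> C) (cf : continuous f) : CE :=
  contfun_of (@infpath_compact E) cf.

Definition ev a z : R[i] := (a : continuousType (infpath E) C) z.

Lemma Cext a b : (forall z, ev a z = ev b z) -> a = b.
Proof. exact: contfunP. Qed.

Lemma ev_cts a : continuous (ev a : infpath E -> C).
Proof. exact: contfun_cts. Qed.

Definition X_lact_fun a x z : C := ev a z * ev x z.
Definition X_ract_fun x b z : C := ev x z * ev b (shift z).
Definition X_ip_fun x y z : C :=
  \sum_(w \in [set w | shift w = z]) (ev x w)^* * ev y w.

Lemma X_lact_cts a x : continuous (X_lact_fun a x).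
Proof. by move=> z; exact: (cvgM (@ev_cts a z) (@ev_cts x z)). Qed.

Lemma X_ract_cts x b : continuous (X_ract_fun x b).
Proof.
move=> z; apply: (cvgM (@ev_cts x z)).
exact: (continuous_comp (@shift_continuous E z) (@ev_cts b (shift z))).
Qed.

Lemma X_ip_funE x y z : X_ip_fun x y z =
  \sum_(e | src e == infpath_rng z)
     (ev x (prepend e z))^* * ev y (prepend e z).
Proof. exact: fsum_fiber. Qed.

Lemma X_ip_cts x y : continuous (X_ip_fun x y).
Proof.
move=> z.
pose F w : C := \sum_(e | src e == infpath_rng z)
     (ev x (prepend e w))^* * ev y (prepend e w).
apply: (@continuous_near_eq (infpath E) C _ F); last first.
  apply/nbhs_agreeP; exists 1%N => w zw.
  by rewrite X_ip_funE /infpath_rng zw.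
apply: continuous_sum => e _ w; pose p : CE := star x ** y.
exact: (continuous_comp (@prepend_continuous E e w) (@ev_cts p (prepend e w))).
Qed.

Definition X_lact a x := mkC (@X_lact_cts a x).
Definition X_ract x b := mkC (@X_ract_cts x b).
Definition X_ip x y := mkC (@X_ip_cts x y).

Lemma X_ipE x y z : ev (X_ip x y) z =
  \sum_(e | src e == infpath_rng z)
     (ev x (prepend e z))^* * ev y (prepend e z).
Proof. exact: X_ip_funE. Qed.

Lemma ev_norm x z : `|ev x z| <= `|x|.
Proof. exact: cfnorm_ge. Qed.

Lemma ev_norm_le x (M : R[i]) :
  0 <= M -> (forall z, `|ev x z| <= M) -> `|x| <= M.
Proof. exact: cfnorm_le. Qed.

Lemma X_ip_ge0 x z : 0 <= ev (X_ip x x) z.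
Proof.
by rewrite X_ipE; apply: sumr_ge0 => e _; rewrite mulrC mul_conjC_ge0.
Qed.

Lemma X_ip_ge x z : `|ev x z| ^+ 2 <= ev (X_ip x x) (shift z).
Proof.
rewrite X_ipE (bigD1 (z 0%N))/=; last exact/eqP/infpathP.
rewrite prepend_shift mulrC -normCK lerDl; apply: sumr_ge0 => e _.
by rewrite mulrC mul_conjC_ge0.
Qed.

Lemma norm_le_bimod_norm x : `|x| <= bimod_norm X_ip x.
Proof.
apply: ev_norm_le => [|z]; first by rewrite sqrtC_ge0.
rewrite -[leLHS](@sqrCK _ `|ev x z|)// ler_sqrtC ?nnegrE ?exprn_ge0//.
apply: le_trans (X_ip_ge x z) _; apply: le_trans (ev_norm _ (shift z)).
by rewrite ger0_norm// X_ip_ge0.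
Qed.

Lemma bimod_norm_le x :
  bimod_norm X_ip x <= sqrtC (#|edge E|%:R) * `|x|.
Proof.
rewrite -[X in _ * X](@sqrCK _ `|x|)// /bimod_norm -sqrtCM ?nnegrE ?exprn_ge0//.
rewrite ler_sqrtC ?nnegrE ?mulr_ge0 ?exprn_ge0//.
apply: ev_norm_le => [|z]; first by rewrite mulr_ge0 ?exprn_ge0.
rewrite X_ipE; apply: le_trans (ler_norm_sum _ _ _) _.
rewrite mulr_natl -sumr_const [leRHS](bigID (fun e => src e == infpath_rng z))/=.
apply: ler_wpDr; first by apply: sumr_ge0 => e _; rewrite exprn_ge0.
apply: ler_sum => e _; rewrite normrM norm_conjC -expr2 lerXn2r ?nnegrE//.
exact: ev_norm.
Qed.

Lemma X_complete (u : nat -> CE) :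
  (forall e : R[i], 0 < e -> exists N, forall m n, (N <= m)%N -> (N <= n)%N ->
     bimod_norm X_ip (u m - u n) < e) ->
  exists x : CE, forall e : R[i], 0 < e -> exists N, forall n, (N <= n)%N ->
     bimod_norm X_ip (u n - x) < e.
Proof.
move=> uc.
have /cvg_ex[x ux] : cvg (u @ \oo).
  apply: cauchy_cvg; apply/cauchyP => e e0.
  have [N uN] := uc _ e0; exists (u N).
  exists N => // n /= Nn; rewrite -ball_normE /=.
  by apply: le_lt_trans (norm_le_bimod_norm _) _; exact: uN.
exists x => e e0; pose M : R[i] := sqrtC (#|edge E|%:R) + 1.
have M0 : 0 < M by rewrite ltr_wpDl// sqrtC_ge0.
have eM : 0 < e / M by rewrite divr_gt0.
move/cvgrPdist_lt : ux => /(_ _ eM)[N _ uN].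
exists N => n Nn; apply: le_lt_trans (bimod_norm_le _) _.
apply: (@le_lt_trans _ _ (M * `|u n - x|)).
  by rewrite ler_wpM2r// lerDl.
by rewrite distrC -ltr_pdivlMl// mulrC; exact: uN.
Qed.

Lemma X_ract_linearl b : linear (X_ract^~ b).
Proof.
move=> k x y; apply: Cext => z.
by change ((k * ev x z + ev y z) * ev b (shift z) =
  k * (ev x z * ev b (shift z)) + ev y z * ev b (shift z)); ring.
Qed.
Lemma X_ract_linearr x : linear (X_ract x).
Proof.
move=> k a b; apply: Cext => z.
by change (ev x z * (k * ev a (shift z) + ev b (shift z)) =
  k * (ev x z * ev a (shift z)) + ev x z * ev b (shift z)); ring.
Qed.
Lemma X_ractM x a b : X_ract x (a ** b) = X_ract (X_ract x a) b.
Proof.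
apply: Cext => z.
by change (ev x z * (ev a (shift z) * ev b (shift z)) =
  ev x z * ev a (shift z) * ev b (shift z)); ring.
Qed.
Lemma X_ip_linearr x : linear (X_ip x).
Proof.
move=> k y y'; apply: Cext => z.
change (ev (X_ip x (k *: y + y')) z =
  k * ev (X_ip x y) z + ev (X_ip x y') z).
rewrite !X_ipE mulr_sumr -big_split/=; apply: eq_bigr => e _.
set w := prepend e z.
by change ((ev x w)^* * (k * ev y w + ev y' w) =
  k * ((ev x w)^* * ev y w) + (ev x w)^* * ev y' w); ring.
Qed.
Lemma X_ip_ract x y a : X_ip x (X_ract y a) = X_ip x y ** a.
Proof.
apply: Cext => z.
change (ev (X_ip x (X_ract y a)) z = ev (X_ip x y) z * ev a z).
rewrite !X_ipE mulr_suml; apply: eq_bigr => e /eqP ez.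
change ((ev x (prepend e z))^* *
  (ev y (prepend e z) * ev a (shift (prepend e z))) =
  (ev x (prepend e z))^* * ev y (prepend e z) * ev a z).
by rewrite shift_prepend// mulrA.
Qed.
Lemma X_star_ip x y : star (X_ip x y) = X_ip y x.
Proof.
apply: Cext => z; change ((ev (X_ip x y) z)^* = ev (X_ip y x) z).
rewrite !X_ipE rmorph_sum; apply: eq_bigr => e _ /=.
by rewrite rmorphM /= conjCK mulrC.
Qed.
Lemma X_ip_cpos x : cpos (X_ip x x).
Proof. exact: (contfun_ge0_cpos (X_ip_ge0 x)). Qed.
Lemma X_ip_eq0 x : X_ip x x = 0 -> x = 0.
Proof.
move=> x0; apply/eqP; rewrite -normr_le0.
by apply: le_trans (norm_le_bimod_norm x) _; rewrite /bimod_norm x0 normr0 sqrtC0.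
Qed.
Lemma X_lact_linearl x : linear (X_lact^~ x).
Proof.
move=> k a b; apply: Cext => z.
by change ((k * ev a z + ev b z) * ev x z =
  k * (ev a z * ev x z) + ev b z * ev x z); ring.
Qed.
Lemma X_lactM a b x : X_lact (a ** b) x = X_lact a (X_lact b x).
Proof.
apply: Cext => z.
by change (ev a z * ev b z * ev x z = ev a z * (ev b z * ev x z)); ring.
Qed.
Lemma X_lact_adjoint a x y : X_ip (X_lact a x) y = X_ip x (X_lact (star a) y).
Proof.
apply: Cext => z; rewrite !X_ipE; apply: eq_bigr => e _.
set w := prepend e z.
change ((ev a w * ev x w)^* * ev y w = (ev x w)^* * ((ev a w)^* * ev y w)).
by rewrite rmorphM /= mulrCA mulrA.
Qed.

Definition X_infpath : hilbert_bimodule CE := HilbertBimodule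
  X_ract_linearl X_ract_linearr X_ractM X_ip_linearr X_ip_ract X_star_ip
  X_ip_cpos X_ip_eq0 X_complete X_lact_linearl X_lactM X_lact_adjoint.

End PathBimodule.


Section StarHomomorphisms.
Variable R : realType.
Implicit Types A B : cstarType R.

Definition star_hom A B (f : A -> B) :=
  [/\ linear f, forall a b, f (a ** b) = f a ** f b
    & forall a, f (star a) = star (f a)].

Definition star_subalgebra A (D : set A) :=
  [/\ D 0, forall (k : R[i]) a b, D a -> D b -> D (k *: a + b),
      forall a b, D a -> D b -> D (a ** b) & forall a, D a -> D (star a)].

Definition generates A (G : set A) :=
  forall D : set A, closed D -> star_subalgebra D -> G `<=` D -> D = setT.

Definition closed_ideal A (I : set A) :=
  [/\ closed I, I 0, forall (k : R[i]) a b, I a -> I b -> I (k *: a + b)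
    & forall a b, I a -> I (a ** b) /\ I (b ** a)].

Definition ideal_generated_by A (G : set A) : set A :=
  [set a | forall I : set A, closed_ideal I -> G `<=` I -> I a].

(* The norm of B needs no condition: a surjective *-homomorphism of C*-algebras
   induces an isometry on the quotient of A by its kernel. *)
Definition is_quotient A B (I : set A) (q : A -> B) :=
  [/\ star_hom q, forall b, exists a, q a = b & [set a | q a = 0] = I].

End StarHomomorphisms.

Section CuntzPimsner.
Variables (R : realType) (A : cstarType R) (X : hilbert_bimodule A).
Implicit Types (B : cstarType R) (S T : X -> X).

Definition is_adjoint S T := forall x y, hip (S x) y = hip x (T y).

Definition theta (x y : X) : X -> X := fun z => ract x (hip y z).

Definition span_theta T := exists n (k : 'I_n -> R[i]) (x y : 'I_n -> X),
  T = fun z => \sum_i k i *: theta (x i) (y i) z.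

Definition hb_norm (x : X) : R[i] := bimod_norm (@hip R A X) x.

(* K(X): the adjointable operators in the operator-norm closure of the span
   of the theta x y. *)
Definition compact_op T :=
  (exists S, is_adjoint T S) /\
  forall e : R[i], 0 < e -> exists F, span_theta F /\
    forall x, hb_norm (T x - F x) <= e * hb_norm x.

Definition is_representation B (psi : X -> B) (pi : A -> B) :=
  [/\ linear psi, star_hom pi,
      forall a x b, psi (lact a (ract x b)) = pi a ** psi x ** pi b
    & forall x y, pi (hip x y) = star (psi x) ** psi y].

Definition is_toeplitz B (psi : X -> B) (pi : A -> B) :=
  [/\ is_representation psi pi, generates (range psi `|` range pi)
    & forall B' (psi' : X -> B') (pi' : A -> B'),
        is_representation psi' pi' -> exists! h : B -> B',
          [/\ star_hom h, forall x, h (psi x) = psi' x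
            & forall a, h (pi a) = pi' a]].

(* rho restricts to the homomorphism (psi, pi)^(1) of K(X) into B; its values
   outside K(X) are irrelevant. *)
Definition is_rep1 B (psi : X -> B) (rho : (X -> X) -> B) :=
  [/\ forall (k : R[i]) S T, compact_op S -> compact_op T ->
        rho (fun x => k *: S x + T x) = k *: rho S + rho T,
      forall S T, compact_op S -> compact_op T ->
        rho (S \o T) = rho S ** rho T,
      forall S T, compact_op S -> compact_op T -> is_adjoint S T ->
        rho T = star (rho S)
    & forall x y, rho (theta x y) = psi x ** star (psi y)].

Definition is_cuntz_pimsner B B' (pi : A -> B) (rho : (X -> X) -> B)
    (q : B -> B') :=
  is_quotient (ideal_generated_by
    [set pi a - rho (lact a) | a in [set a | compact_op (@lact R A X a)]]) q.

Definition is_toeplitz_gauge B (psi : X -> B) (pi : A -> B)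
    (gamma : R[i] -> B -> B) :=
  forall z, `|z| = 1 ->
    [/\ star_hom (gamma z), forall x, gamma z (psi x) = z *: psi x
      & forall a, gamma z (pi a) = pi a].

End CuntzPimsner.

Section GraphAlgebras.
Variables (R : realType) (E : digraph).
Implicit Types B : cstarType R.

Definition is_projection B (p : B) := p ** p = p /\ star p = p.

Definition is_partial_isometry B (s : B) := s ** star s ** s = s.

Definition is_tck_family B (S : edge E -> B) (P : vertex E -> B) :=
  [/\ (forall v, is_projection (P v)) /\ (forall e, is_partial_isometry (S e)),
      forall v w, v != w -> P v ** P w = 0,
      forall e, star (S e) ** S e = P (src e)
    & forall v, cle (\sum_(e | rng e == v) S e ** star (S e)) (P v)].

Definition is_ck_family B (S : edge E -> B) (P : vertex E -> B) :=
  is_tck_family S P /\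
  forall v, (exists e, rng e = v) ->
    P v = \sum_(e | rng e == v) S e ** star (S e).

(* h is the homomorphism pi_{S,P} on the algebra of (s, p). *)
Definition is_family_hom B B' (s : edge E -> B) (p : vertex E -> B)
    (S : edge E -> B') (P : vertex E -> B') (h : B -> B') :=
  [/\ star_hom h, forall e, h (s e) = S e & forall v, h (p v) = P v].

Definition is_TCstar B (s : edge E -> B) (p : vertex E -> B) :=
  is_tck_family s p /\
  forall B' (S : edge E -> B') (P : vertex E -> B'),
    is_tck_family S P -> exists! h, is_family_hom s p S P h.

Definition is_Cstar B (s : edge E -> B) (p : vertex E -> B) :=
  is_ck_family s p /\
  forall B' (S : edge E -> B') (P : vertex E -> B'),
    is_ck_family S P -> exists! h, is_family_hom s p S P h.

Definition is_graph_gauge B (s : edge E -> B) (p : vertex E -> B)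
    (gamma : R[i] -> B -> B) :=
  forall z, `|z| = 1 ->
    [/\ star_hom (gamma z), forall e, gamma z (s e) = z *: s e
      & forall v, gamma z (p v) = p v].

End GraphAlgebras.

(* Main.v *)
Require Import Defs.
From mathcomp Require Import all_boot all_order all_algebra.
From mathcomp Require Import complex ring.
From mathcomp Require Import all_classical all_reals all_analysis.
Import Order.TTheory GRing.Theory Num.Theory.
Import numFieldNormedType.Exports.
Local Open Scope classical_set_scope.
Local Open Scope ring_scope.

Set Implicit Arguments.
Unset Strict Implicit.

(* Over a graph without sources, choose for every vertex v an infinite path z_v
   with range v.  For a Toeplitz-Cuntz-Krieger family (S, P) with gaps
   Q_v = P_v - sum_(r(e) = v) S_e S_e^*, the iteration
     pi_0(a) = sum_v a(z_v) P_v,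
     pi_(n+1)(a) = sum_v a(z_v) Q_v + sum_e S_e pi_n(a(e . )) S_e^*
   consists of homomorphisms of C(E^oo) and is eventually constant on
   locally constant functions.  Its limit pi and
   psi(x) = sum_e S_e pi(x(e . )) represent X(E^oo) in the algebra of the family,
   with psi(chi_Z(e)) = S_e and pi(chi_Z(v)) = P_v.  Applied to TC*(E) this gives
   a left inverse of pi_{S,P}; applied to C*(E), where Q = 0, it kills the
   Cuntz-Pimsner ideal and gives a left inverse of C*(E) -> O(X(E^oo)).
   Surjectivity holds because the range of a homomorphism is closed and the range
   of C*(E) contains the generators of O(X(E^oo)); the gauge actions are compared
   on generators.
   The facts on C*-algebras are obtained without spectral theory: if s is
   self-adjoint with |s| < 1, a fixed point argument gives k with
   s^2 + (1 - k)^2 = 1, and then 1 - k + i s is unitary.  The relation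
   sum_(r(e) = v) S_e S_e^* <= P_v forces the range projections of the S_e to be
   orthogonal and below P_v, because -x^* x is positive only for x = 0. *)

(** * Normed modules *)

Section NormedModules.
Variable R : realType.

Lemma dist_closure (V : normedModType R[i]) (D : set V) (x : V) :
  closure D x <-> forall e : R[i], 0 < e -> exists2 y, D y & `|x - y| < e.
Proof.
split=> [Dx e e0|Dx B /nbhs_ballP[e e0 xeB]].
  have [y [Dy]] := Dx _ (nbhsx_ballx x e e0).
  by rewrite -ball_normE => xy; exists y.
have [y Dy xy] := Dx _ e0; exists y; split=> //; apply: xeB.
by rewrite -ball_normE.
Qed.

Lemma lipschitz_cts (U V : normedModType R[i]) (f : U -> V) (M : R[i]) :
  0 <= M -> (forall x y, `|f x - f y| <= M * `|x - y|) -> continuous f.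
Proof.
move=> M0 fM x; apply/cvgrPdist_lt => e e0.
have M1 : 0 < M + 1 by rewrite ltr_wpDl.
have /cvgrPdist_lt/(_ (e / (M + 1))) : id @ nbhs x --> x by [].
rewrite divr_gt0// => /(_ isT); apply: filterS => y xy.
apply: le_lt_trans (fM _ _) _; apply: (@le_lt_trans _ _ ((M + 1) * `|x - y|)).
  by rewrite ler_wpM2r// lerDl.
by rewrite -ltr_pdivlMl// mulrC.
Qed.

Lemma closed_norm_le (V : normedModType R[i]) (M : R[i]) :
  closed [set x : V | `|x| <= M].
Proof.
move=> x /dist_closure Dx /=; apply/ler_addgt0Pr => e /Dx[y /= yM xy].
rewrite -(subrK y x) addrC; apply: le_trans (ler_normD _ _) _.
by apply: lerD => //; exact: ltW.
Qed.

Lemma closed_eqfun (U V : normedModType R[i]) (f g : U -> V) :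
  continuous f -> continuous g -> closed [set x | f x = g x].
Proof.
move=> cf cg.
rewrite (_ : [set x | _] = (fun x => f x - g x) @^-1` [set y | `|y| <= 0]).
  apply: preimage_closed; last exact: closed_norm_le.
  by move=> x _; apply: cvgB; [exact: cf|exact: cg].
by apply/seteqP; split=> x /=; rewrite normr_le0 subr_eq0 => /eqP.
Qed.

Lemma expr_small (r e : R[i]) : 0 <= r < 1 -> 0 < e ->
  exists N, forall n, (N <= n)%N -> r ^+ n < e.
Proof.
move=> /andP[r0 r1] e0.
(* The order of [R[i]] compares only numbers with equal imaginary parts, so [0 <= r < 1] makes [r]
   real and the limit can be taken in [R]. *)
have rE : r = (complex.Re r)%:C%C by rewrite RRe_real// ger0_real.
have eE : e = (complex.Re e)%:C%C by rewrite RRe_real// gtr0_real.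
have : `|complex.Re r| < 1 by rewrite ger0_norm -?ltcR -?lecR -rE.
have re0 : 0 < complex.Re e by rewrite -ltcR -eE.
move=> /cvg_expr/cvgrPdist_lt/(_ _ re0)[N _ rN]; exists N => n /rN.
rewrite /= sub0r normrN => {}rN.
by rewrite eE rE -rmorphXn ltcR; apply: le_lt_trans rN; rewrite ler_norm.
Qed.

Lemma geometric_cvg (V : completeNormedModType R[i]) (u : nat -> V)
    (M r : R[i]) : 0 <= r < 1 ->
  (forall n, `|u n.+1 - u n| <= M * r ^+ n) -> cvgn u.
Proof.
move=> r01 ur; have /andP[r0 r1] := r01.
have M0 : 0 <= M by have := le_trans (normr_ge0 _) (ur 0%N); rewrite mulr1.
have r10 : 0 < 1 - r by rewrite subr_gt0.
have tail n m : `|u (n + m)%N - u n| <= M * r ^+ n / (1 - r).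
  have : `|u (n + m)%N - u n| <= M * r ^+ n * (1 - r ^+ m) / (1 - r).
    elim: m => [|m IH]; first by rewrite addn0 !subrr normr0 mulr0 mul0r.
    rewrite addnS -(subrKA (u (n + m)%N)).
    apply: le_trans (ler_normD _ _) _; apply: le_trans (lerD (ur _) IH) _.
    rewrite le_eqVlt; apply/orP; left; apply/eqP; rewrite exprD exprS.
    by field; rewrite subr_eq0 eq_sym lt_eqF.
  move/le_trans; apply; rewrite ler_wpM2r ?invr_ge0 ?(ltW r10)//.
  by rewrite ler_piMr ?mulr_ge0 ?exprn_ge0// gerBl exprn_ge0.
apply/cauchy_cvgP/cauchyP => e e0.
pose c := M / (1 - r) + 1.
have c0 : 0 < c by rewrite ltr_wpDl// divr_ge0// ltW.
have ec0 : 0 < e / c by rewrite divr_gt0.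
have [N /(_ N (leqnn N)) rN] := expr_small r01 ec0.
exists (u N); exists N => // n /= Nn.
rewrite -ball_normE /= distrC -(subnKC Nn).
apply: le_lt_trans (tail _ _) _.
rewrite mulrAC; apply: (@le_lt_trans _ _ (c * r ^+ N)).
  by rewrite ler_wpM2r ?exprn_ge0// lerDl.
by rewrite -ltr_pdivlMl// mulrC.
Qed.

(** The Banach fixed point theorem on a closed set. It replaces functional calculus: the square
    roots and resolvents below are fixed points of such maps. *)
Lemma contraction_fixpoint (V : completeNormedModType R[i]) (D : set V)
    (T : V -> V) (r : R[i]) : 0 <= r < 1 -> closed D -> D !=set0 ->
  (forall x, D x -> D (T x)) ->
  (forall x y, D x -> D y -> `|T x - T y| <= r * `|x - y|) ->
  exists2 x, D x & T x = x.
Proof.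
move=> r01 cD [x0 Dx0] DT Tr; pose u n := iter n T x0.
have Du n : D (u n) by elim: n => //= n; exact: DT.
have r0 : 0 <= r by case/andP: r01.
have uS n : `|u n.+1 - u n| <= `|T x0 - x0| * r ^+ n.
  elim: n => [|n IH]; first by rewrite mulr1.
  apply: (le_trans (Tr (u n.+1) (u n) (Du _) (Du _))).
  by rewrite exprS mulrCA ler_wpM2l.
have /cvg_ex[x ux] := geometric_cvg r01 uS.
have Dx : D x by apply: closed_cvg cD _ x ux; exact: nearW.
exists x => //; apply/eqP; rewrite -subr_eq0 -normr_le0.
apply/ler_addgt0Pr => e e0; rewrite add0r.
have e20 : 0 < e / 2 by rewrite divr_gt0.
move/cvgrPdist_lt : ux => /(_ _ e20)[N _ uN].
rewrite -(subrKA (u N.+1)) [e]splitr; apply: le_trans (ler_normD _ _) _.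
have {}uN n : (N <= n)%N -> `|x - u n| <= e / 2 by move=> /uN/ltW.
apply: lerD; last by rewrite distrC uN.
apply: (le_trans (Tr x (u N) Dx (Du _))); apply: le_trans (uN _ (leqnn N)).
by rewrite ler_piMl// ltW//; case/andP: r01.
Qed.

End NormedModules.

(** * Elementary theory of C*-algebras *)

Section CStarBasics.
Variable R : realType.
Implicit Types A B : cstarType R.

Lemma cmulDl A (a b c : A) : (a + b) ** c = a ** c + b ** c.
Proof. by have := cmul_linearl c 1 a b; rewrite !scale1r. Qed.

Lemma cmulDr A (a b c : A) : a ** (b + c) = a ** b + a ** c.
Proof. by have := cmul_linearr a 1 b c; rewrite !scale1r. Qed.

Lemma cmul0l A (a : A) : 0 ** a = 0.
Proof. by apply: (addIr (0 ** a)); rewrite -cmulDl !add0r. Qed.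

Lemma cmul0r A (a : A) : a ** 0 = 0.
Proof. by apply: (addIr (a ** 0)); rewrite -cmulDr !add0r. Qed.

Lemma cmulZl A (k : R[i]) (a b : A) : (k *: a) ** b = k *: (a ** b).
Proof. by have := cmul_linearl b k a 0; rewrite cmul0l !addr0. Qed.

Lemma cmulZr A (k : R[i]) (a b : A) : a ** (k *: b) = k *: (a ** b).
Proof. by have := cmul_linearr a k b 0; rewrite cmul0r !addr0. Qed.

Lemma cmulNl A (a b : A) : (- a) ** b = - (a ** b).
Proof. by rewrite -scaleN1r cmulZl scaleN1r. Qed.

Lemma cmulNr A (a b : A) : a ** (- b) = - (a ** b).
Proof. by rewrite -[in LHS]scaleN1r cmulZr scaleN1r. Qed.

Lemma cmulBl A (a b c : A) : (a - b) ** c = a ** c - b ** c.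
Proof. by rewrite cmulDl cmulNl. Qed.

Lemma cmulBr A (a b c : A) : a ** (b - c) = a ** b - a ** c.
Proof. by rewrite cmulDr cmulNr. Qed.

Lemma cmul_suml A (I : Type) (r : seq I) (P : pred I) (F : I -> A) (b : A) :
  (\sum_(i <- r | P i) F i) ** b = \sum_(i <- r | P i) (F i ** b).
Proof.
by apply: (big_morph (fun a : A => a ** b));
  [move=> x y; exact: cmulDl|exact: cmul0l].
Qed.

Lemma cmul_sumr A (I : Type) (r : seq I) (P : pred I) (F : I -> A) (b : A) :
  b ** (\sum_(i <- r | P i) F i) = \sum_(i <- r | P i) (b ** F i).
Proof.
by apply: (big_morph (cmul b)); [move=> x y; exact: cmulDr|exact: cmul0r].
Qed.

Lemma starD A (a b : A) : star (a + b) = star a + star b.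
Proof. by have := star_antilinear 1 a b; rewrite conjC1 !scale1r. Qed.

Lemma star0 A : star (0 : A) = 0.
Proof. by apply: (addIr (star (0 : A))); rewrite -starD !add0r. Qed.

Lemma starZ A (k : R[i]) (a : A) : star (k *: a) = k^* *: star a.
Proof. by have := star_antilinear k a 0; rewrite star0 !addr0. Qed.

Lemma starN A (a : A) : star (- a) = - star a.
Proof. by rewrite -[in LHS]scaleN1r starZ rmorphN1 scaleN1r. Qed.

Lemma starB A (a b : A) : star (a - b) = star a - star b.
Proof. by rewrite starD starN. Qed.

Lemma star_sum A (I : Type) (r : seq I) (P : pred I) (F : I -> A) :
  star (\sum_(i <- r | P i) F i) = \sum_(i <- r | P i) star (F i).
Proof. by apply: big_morph; [exact: starD|exact: star0]. Qed.

Lemma norm_star A (a : A) : `|star a| = `|a|.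
Proof.
have le (b : A) : `|b| <= `|star b|.
  have [->|b0] := eqVneq b 0; first by rewrite normr0.
  have bp : 0 < `|b| by rewrite normr_gt0.
  by rewrite -(ler_pM2r bp) -expr2 -cstar_identity cnormM.
by apply/eqP; rewrite eq_le le andbT -[X in _ <= `|X|](starK a) le.
Qed.

Lemma norm_selfadjoint_sq A (a : A) : star a = a -> `|a ** a| = `|a| ^+ 2.
Proof. by move=> {1}<-; exact: cstar_identity. Qed.

Lemma star_cts A : continuous (@star R A).
Proof.
by apply: (@lipschitz_cts _ _ _ _ 1) => // x y; rewrite -starB norm_star mul1r.
Qed.

Lemma cmull_cts A (a : A) : continuous (cmul a).
Proof.
by apply: (@lipschitz_cts _ _ _ _ `|a|) => // x y; rewrite -cmulBr cnormM.
Qed.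

Lemma cmulr_cts A (a : A) : continuous (fun x => x ** a).
Proof.
apply: (@lipschitz_cts _ _ _ _ `|a|) => // x y.
by rewrite -cmulBl mulrC cnormM.
Qed.

Lemma cmul_cvg A (u v : nat -> A) (x y : A) :
  u @ \oo --> x -> v @ \oo --> y -> (fun n => u n ** v n) @ \oo --> x ** y.
Proof.
move=> ux vy.
rewrite (_ : (fun n => u n ** v n) =
    (fun n => (u n - x) ** (v n - y) + (x ** (v n - y) + u n ** y))); last first.
  by apply/funext => n; rewrite cmulBl addrA subrK cmulBr subrK.
rewrite -[x ** y]add0r; apply: cvgD.
  apply/cvgrPdist_lt => e e0; near=> n; rewrite sub0r normrN.
  apply: le_lt_trans (cnormM _ _) _.
  apply: (@le_lt_trans _ _ (1 * `|v n - y|)).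
    apply: ler_wpM2r => //; rewrite distrC; near: n.
    by move/cvgrPdist_le : ux; apply.
  by rewrite mul1r distrC; near: n; move/cvgrPdist_lt : vy; apply.
rewrite -[x ** y]add0r -{1}(cmul0r x); apply: cvgD.
  apply: (continuous_cvg _ (@cmull_cts _ x 0)).
  by rewrite -(subrr y); apply: cvgB => //; exact: cvg_cst.
exact: (continuous_cvg _ (@cmulr_cts _ y x) ux).
Unshelve. all: by end_near. Qed.

Lemma half_double A (a : A) : 2^-1 *: (a + a) = a.
Proof. by rewrite -[X in X + X]scale1r -scalerDl scalerA mulVf ?scale1r. Qed.

Lemma imaginary_unit : exists i : R[i], [/\ i * i = -1, i^* = - i & `|i| = 1].
Proof.
have ii : 'i * 'i = -1 :> R[i] by rewrite -expr2 sqrCi.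
by exists 'i; rewrite conjCi normCi.
Qed.

(** The last hypothesis makes the cross terms of [star (r + i *: t) ** (r + i *: t)] cancel. *)
Lemma norm_add_imaginary A (r t : A) (i : R[i]) : i * i = -1 -> i^* = - i ->
  star r ** t = star t ** r ->
  `|r + i *: t| ^+ 2 = `|star r ** r + star t ** t|.
Proof.
move=> ii ci rt; rewrite -cstar_identity; congr `|_|.
have iie (x : A) : i *: (i *: x) = - x by rewrite scalerA ii scaleN1r.
rewrite starD starZ ci scaleNr cmulBl !cmulDr !cmulZl !cmulZr iie rt.
by rewrite opprD opprK addrA addrK.
Qed.

(** The element [d] is the real part of [d + i *: e], whose squared norm is the right-hand side.
    This takes the place of monotonicity of the norm on positive elements. *)
Lemma norm_sq_le_sum A (d e : A) : star d = d -> star e = e ->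
  d ** e = e ** d -> `|d| ^+ 2 <= `|d ** d + e ** e|.
Proof.
move=> sd se de; have [i [ii ci i1]] := imaginary_unit.
have := @norm_add_imaginary _ d e i ii ci; rewrite sd se => /(_ de) <-.
rewrite lerXn2r ?nnegrE//.
set w := d + i *: e.
have -> : d = 2^-1 *: (w + star w).
  rewrite /w starD starZ sd se ci scaleNr addrACA subrr addr0.
  by rewrite half_double.
rewrite normrZ ger0_norm ?invr_ge0// ler_pdivrMl//.
by apply: le_trans (ler_normD _ _) _; rewrite norm_star mulr_natl mulr2n.
Qed.

(** A closed set, stable under the iterations below, in which elements commute with each other when
    [s] is self-adjoint. A fixed point found in it is self-adjoint and commutes with whatever
    commutes with [s]. *)
Definition sa_bicommutant A (s : A) : set A :=
  [set y | star y = y /\ forall x, x ** s = s ** x -> x ** y = y ** x].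

Lemma sa_bicommutant_closed A (s : A) : closed (sa_bicommutant s).
Proof.
rewrite (_ : sa_bicommutant s = [set y | star y = y] `&`
    \bigcap_(x in [set x | x ** s = s ** x]) [set y | x ** y = y ** x]).
  apply: closedI.
    by apply: closed_eqfun; [exact: star_cts|move=> x; exact: cvg_id].
  apply: closed_bigI => x _.
  by apply: closed_eqfun; [exact: cmull_cts|exact: cmulr_cts].
by apply/seteqP; split=> y [sy cy]; split.
Qed.

Lemma sa_bicommutant_comm A (s y z : A) : star s = s ->
  sa_bicommutant s y -> sa_bicommutant s z -> y ** z = z ** y.
Proof. by move=> ss [_ cy] [_ cz]; apply: cz; rewrite cy. Qed.

Lemma sa_bicommutant0 A (s : A) : sa_bicommutant s 0.
Proof. by split=> [|x _]; rewrite ?star0 ?cmul0l ?cmul0r. Qed.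

Lemma sa_bicommutantD A (s y z : A) :
  sa_bicommutant s y -> sa_bicommutant s z -> sa_bicommutant s (y + z).
Proof.
move=> [sy cy] [sz cz]; split=> [|x xs]; first by rewrite starD sy sz.
by rewrite cmulDl cmulDr cy// cz.
Qed.

Lemma sa_bicommutantZ A (s y : A) (k : R[i]) : 0 <= k ->
  sa_bicommutant s y -> sa_bicommutant s (k *: y).
Proof.
move=> k0 [sy cy]; split=> [|x xs]; last by rewrite cmulZl cmulZr cy.
by rewrite starZ sy conj_Creal// ger0_real.
Qed.

Lemma sa_bicommutantN A (s y : A) :
  sa_bicommutant s y -> sa_bicommutant s (- y).
Proof.
move=> [sy cy]; split=> [|x xs]; first by rewrite starN sy.
by rewrite cmulNl cmulNr cy.
Qed.

Lemma sa_bicommutantM A (s y z : A) : star s = s ->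
  sa_bicommutant s y -> sa_bicommutant s z -> sa_bicommutant s (y ** z).
Proof.
move=> ss hy hz; split=> [|x xs].
  by rewrite starM hy.1 hz.1 (sa_bicommutant_comm ss hz hy).
by rewrite cmulA (hy.2 x)// -cmulA (hz.2 x)// cmulA.
Qed.

(* In the unitization, k = 1 - sqrt (1 - s^2). *)
Lemma one_minus_sqrt A (s : A) : star s = s -> `|s| < 1 ->
  exists2 k, sa_bicommutant s k & s ** s = k + k - k ** k.
Proof.
move=> ss s1; pose r := `|s| ^+ 2.
have r0 : 0 <= r by rewrite exprn_ge0.
have r1 : r < 1 by rewrite exprn_ilt1.
(* A fixed point of [T] solves $s^2 = 2k - k^2$. On the ball of radius $r = |s|^2$, [T] has values
   of norm at most $(r + r^2)/2 \le r$ and Lipschitz constant [r]. *)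
pose T k := 2^-1 *: (s ** s + k ** k).
pose D := sa_bicommutant s `&` [set k | `|k| <= r].
have [|||||k [Dk _] Tk] := @contraction_fixpoint R A D T r.
- by rewrite r0 r1.
- by apply: closedI; [exact: sa_bicommutant_closed|exact: closed_norm_le].
- by exists 0; split; [exact: sa_bicommutant0|rewrite /= normr0].
- move=> k [Dk /= kr]; split.
    apply: sa_bicommutantZ; first by rewrite invr_ge0.
    by apply: sa_bicommutantD; apply: sa_bicommutantM => //.
  rewrite /= normrZ ger0_norm ?invr_ge0// ler_pdivrMl//.
  apply: le_trans (ler_normD _ _) _; rewrite mulr_natl mulr2n.
  apply: lerD; first by rewrite norm_selfadjoint_sq.
  apply: le_trans (cnormM _ _) _; apply: le_trans (ler_pM _ _ kr kr) _ => //.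
  by rewrite ler_piMr// ltW.
- move=> x y [_ /= xr] [_ /= yr].
  rewrite -scalerBr opprD addrACA subrr add0r normrZ ger0_norm ?invr_ge0//.
  rewrite ler_pdivrMl//.
  have -> : x ** x - y ** y = x ** (x - y) + (x - y) ** y.
    by rewrite cmulBr cmulBl subrKA.
  apply: le_trans (ler_normD _ _) _; rewrite mulr_natl mulr2n.
  apply: lerD; apply: le_trans (cnormM _ _) _.
    by rewrite ler_wpM2r.
  by rewrite mulrC ler_wpM2r.
exists k => //; apply/eqP; rewrite eq_sym subr_eq.
by rewrite -{1 2}Tk /T -scalerDr half_double.
Qed.

(* When s^2 + (1 - k)^2 = 1, the elements 1 - k + i s and 1 - k - i s of the
   unitization are unitary; s and 1 - 2 s^2 are the imaginary part of the
   former and the real part of its square. *)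
Lemma unitary_norm A (s k v : A) (i : R[i]) : i * i = -1 -> i^* = - i ->
  star s = s -> star k = k -> s ** k = k ** s -> s ** s = k + k - k ** k ->
  `|v - k ** v + i *: (s ** v)| = `|v|.
Proof.
move=> ii ci ss sk sk' skk; apply/eqP; rewrite -(@eqrXn2 _ 2)//; apply/eqP.
rewrite norm_add_imaginary//; last first.
  rewrite starB !starM ss sk cmulBl cmulBr !cmulA.
  by rewrite -(cmulA _ s k) sk' !cmulA.
rewrite -cstar_identity; congr `|_|.
have aux (x a b : A) : x - a - (a - b) + (a + a - b) = x.
  by rewrite -[x - a - _]addrA -opprD (addrA a a) subrK.
rewrite starB !starM ss sk cmulBl !cmulBr !cmulA -(cmulA _ s s) skk.
by rewrite !cmulBr cmulDr cmulBl cmulDl !cmulA aux.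
Qed.

Lemma unitary_parts_norm A (s k v : A) : star s = s -> star k = k ->
  s ** k = k ** s -> s ** s = k + k - k ** k ->
  `|s ** v| <= `|v| /\ `|v - 2 *: (s ** (s ** v))| <= `|v|.
Proof.
move=> ss sk sk' skk; have [i [ii ci i1]] := imaginary_unit.
(* Left multiplications by the two unitaries, written without the unit: $(U - V)/2i$ is
   multiplication by $s$, and $(U^2 + V^2)/2$ by $1 - 2s^2$. *)
pose U w := w - k ** w + i *: (s ** w).
pose V w := w - k ** w - i *: (s ** w).
have nU w : `|U w| = `|w| by exact: unitary_norm.
have nV w : `|V w| = `|w|.
  rewrite /V -scaleNr; apply: (@unitary_norm _ s k w (- i)) => //.
    by rewrite mulrNN.
  by rewrite rmorphN/= ci.
split.
  have -> : s ** v = 2^-1 *: (- i *: (U v - V v)).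
    rewrite /U /V opprB addrC subrKA scalerDr scalerA mulNr ii opprK scale1r.
    by rewrite half_double.
  rewrite !normrZ normrN i1 mul1r ger0_norm ?invr_ge0// ler_pdivrMl//.
  by apply: le_trans (ler_normB _ _) _; rewrite nU nV mulr_natl mulr2n.
have -> : v - 2 *: (s ** (s ** v)) = 2^-1 *: (U (U v) + V (V v)).
  have UV X Y : U (X + Y) + V (X - Y) =
      (X - k ** X + i *: (s ** Y)) + (X - k ** X + i *: (s ** Y)).
    have aux (p q r t : A) : X + Y - (p + q) + (r + t) +
        (X - Y - (p - q) - (r - t)) = (X - p + t) + (X - p + t).
      rewrite addrACA [Z in Z + _]addrACA (addrACA X Y) subrr addr0 -opprD.
      rewrite (addrACA p q) subrr addr0 opprB (addrC r t) (addrACA t r).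
      by rewrite subrr addr0 [RHS]addrACA opprD (addrACA X (- p)).
    by rewrite /U /V !cmulBr !cmulDr scalerDr scalerBr aux.
  rewrite UV half_double cmulZr scalerA ii scaleN1r cmulBr.
  rewrite !cmulA skk cmulBl cmulDl scaler_nat mulr2n.
  by rewrite -[v - _ - _]addrA -opprD (addrA (k ** v)) opprD addrA.
rewrite normrZ ger0_norm ?invr_ge0// ler_pdivrMl//.
by apply: le_trans (ler_normD _ _) _; rewrite !nU !nV mulr_natl mulr2n.
Qed.

Lemma norm_sub_double_sq A (s v : A) : star s = s -> `|s| < 1 ->
  `|v - 2 *: (s ** (s ** v))| <= `|v|.
Proof.
move=> ss s1; have [k [sk ck] skk] := one_minus_sqrt ss s1.
by apply: (unitary_parts_norm v ss sk _ skk).2; exact: ck.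
Qed.

(** The multiplier $1 - s^2$ is the mean of $1$ and $1 - 2s^2$. *)
Lemma norm_sub_sq A (s v : A) : star s = s -> `|s| < 1 ->
  `|v - s ** (s ** v)| <= `|v|.
Proof.
move=> ss s1; have le2 := norm_sub_double_sq v ss s1.
have -> : v - s ** (s ** v) = 2^-1 *: (v + (v - 2 *: (s ** (s ** v)))).
  rewrite addrA scaler_nat mulr2n opprD addrACA half_double //.
rewrite normrZ ger0_norm ?invr_ge0// ler_pdivrMl// mulr_natl mulr2n.
by apply: le_trans (ler_normD _ _) _; rewrite lerD2l.
Qed.

End CStarBasics.

(** * Homomorphisms: contractivity and closed range *)

Section StarHoms.
Variable R : realType.
Implicit Types A B : cstarType R.

Lemma commuteM A (a b c : A) : a ** b = b ** a -> a ** c = c ** a ->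
  a ** (b ** c) = (b ** c) ** a.
Proof. by move=> ab ac; rewrite cmulA ab -cmulA ac cmulA. Qed.

(* y is s / (1 + s^2); z = y s satisfies z = z^2 + y^2, whence the bound. *)
Lemma resolvent_selfadjoint A (s : A) : star s = s ->
  exists y, [/\ star y = y, y + y ** (s ** s) = s & `|y| <= 1].
Proof.
move=> ss; pose c : R[i] := `|s| + 1.
have c0 : 0 < c by rewrite ltr_wpDl.
have d0 : 0 < 1 + c ^+ 2 by rewrite ltr_wpDr// exprn_ge0// ltW.
(* A fixed point solves $(1 + s^2) y = s$. Since $|s| < c$, the multiplier $c^2 - s^2 = c^2 (1 -
   (s/c)^2)$ has norm at most $c^2$, which gives the ratio $c^2/(1 + c^2) < 1$. *)
pose T y := (1 + c ^+ 2)^-1 *: (s + (c ^+ 2 *: y - (s ** s) ** y)).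
have [|||||y [sy cy] Ty] :=
    @contraction_fixpoint R A (sa_bicommutant s) T (c ^+ 2 / (1 + c ^+ 2)).
- rewrite divr_ge0 ?exprn_ge0 ?(ltW c0) ?(ltW d0)//= ltr_pdivrMr// mul1r.
  by rewrite ltrDr.
- exact: sa_bicommutant_closed.
- by exists 0; exact: sa_bicommutant0.
- move=> y Dy; apply: sa_bicommutantZ; first by rewrite invr_ge0 ltW.
  apply: sa_bicommutantD => //; apply: sa_bicommutantD.
    by apply: sa_bicommutantZ => //; rewrite exprn_ge0// ltW.
  by apply: sa_bicommutantN; do 2! apply: sa_bicommutantM => //.
- move=> x y Dx Dy.
  have -> : T x - T y =
      (1 + c ^+ 2)^-1 *: (c ^+ 2 *: (x - y) - s ** s ** (x - y)).
    rewrite -scalerBr; congr (_ *: _).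
    rewrite opprD addrACA subrr add0r scalerBr cmulBr !opprB.
    by rewrite [LHS]addrACA [RHS]addrACA (addrC (- (_ ** x))).
  move: (x - y) => z.
  have [s' [cs ss' s'1]] : exists s', [/\ s = c *: s', star s' = s' &
      `|s'| < 1].
    exists (c^-1 *: s); split.
    + by rewrite scalerA divff ?scale1r// gt_eqF.
    + by rewrite starZ ss conj_Creal// ger0_real// invr_ge0 ltW.
    + rewrite normrZ ger0_norm ?invr_ge0 ?(ltW c0)// mulrC ltr_pdivrMr//.
      by rewrite mul1r ltrDl.
  have -> : c ^+ 2 *: z - s ** s ** z = c ^+ 2 *: (z - s' ** (s' ** z)).
    by rewrite scalerBr cs !cmulZl !cmulZr !cmulZl scalerA expr2 cmulA.
  have nZ (k : R[i]) (t : A) : 0 < k -> `|k *: t| = k * `|t|.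
    by move=> k0; rewrite normrZ gtr0_norm.
  rewrite nZ ?invr_gt0// nZ ?exprn_gt0//.
  rewrite mulrA (mulrC _^-1); apply: ler_wpM2l.
    by rewrite divr_ge0 ?exprn_ge0 ?(ltW c0) ?(ltW d0).
  exact: norm_sub_sq.
have ys : y ** s = s ** y by rewrite cy.
have yss : s ** s ** y = y ** (s ** s) by rewrite -cmulA -ys cmulA -ys -cmulA.
have yE : y + y ** (s ** s) = s.
  have : (1 + c ^+ 2) *: y = s + (c ^+ 2 *: y - s ** s ** y).
    by rewrite -{1}Ty /T scalerA divff ?scale1r// gt_eqF.
  rewrite scalerDl scale1r yss => yE.
  apply: (addIr (c ^+ 2 *: y - y ** (s ** s))).
  by rewrite -yE addrACA subrr addr0.
exists y; split=> //; pose z := y ** s.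
have zE : z = y ** y + z ** z.
  have -> : z ** z = y ** (y ** (s ** s)).
    by rewrite /z -[LHS]cmulA (cmulA s y s) -ys -cmulA.
  by rewrite -cmulDr yE.
have sz : star z = z by rewrite /z starM sy ss ys.
have yz : y ** z = z ** y by exact: commuteM.
(* Both bounds come from [norm_sq_le_sum]: $|z|^2 \le |z^2 + y^2| = |z|$, and then $|y|^2 \le |z|
   \le 1$. *)
have z1 : `|z| <= 1.
  have : `|z| ^+ 2 <= `|z|.
    by rewrite [X in _ <= `|X|]zE [X in _ <= `|X|]addrC; apply: norm_sq_le_sum.
  have [->|z0] := eqVneq z 0; first by rewrite normr0.
  by rewrite expr2 ger_pMr ?normr_gt0.
rewrite -(@ler_pXn2r _ 2)// ?nnegrE// expr1n; apply: le_trans z1.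
by rewrite [X in _ <= `|X|]zE; exact: norm_sq_le_sum.
Qed.

Section Homs.
Variables (A B : cstarType R) (f : A -> B).
Hypothesis fhom : star_hom f.

Lemma hom0 : f 0 = 0.
Proof.
case: fhom => fl _ _; have := fl 1 0 0; rewrite !scale1r addr0 => f0.
by apply: (addIr (f 0)); rewrite add0r -f0.
Qed.

Lemma homD (a b : A) : f (a + b) = f a + f b.
Proof. by case: fhom => fl _ _; have := fl 1 a b; rewrite !scale1r. Qed.

Lemma homZ (k : R[i]) (a : A) : f (k *: a) = k *: f a.
Proof. by case: fhom => fl _ _; have := fl k a 0; rewrite hom0 !addr0. Qed.

Lemma homN (a : A) : f (- a) = - f a.
Proof. by rewrite -scaleN1r homZ scaleN1r. Qed.

Lemma homB (a b : A) : f (a - b) = f a - f b.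
Proof. by rewrite homD homN. Qed.

Lemma homM (a b : A) : f (a ** b) = f a ** f b.
Proof. by case: fhom. Qed.

Lemma homS (a : A) : f (star a) = star (f a).
Proof. by case: fhom. Qed.

Lemma hom_sum (I : Type) (r : seq I) (P : pred I) (F : I -> A) :
  f (\sum_(i <- r | P i) F i) = \sum_(i <- r | P i) f (F i).
Proof. exact: (big_morph f homD hom0). Qed.

(** For self-adjoint [h] of norm below 1, [f] preserves the relation $h^2 = 2k - k^2$, so [f h] is
    the imaginary part of a unitary and multiplies contractively. Scaling and the C*-identity give
    the general case. *)
Lemma hom_norm_le (a : A) : `|f a| <= `|a|.
Proof.
have small (h : A) : star h = h -> `|h| < 1 -> `|f h| <= 1.
  move=> sh h1; have [k [sk ck] hk] := one_minus_sqrt sh h1.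
  have sfh : star (f h) = f h by rewrite -homS sh.
  have sfk : star (f k) = f k by rewrite -homS sk.
  have cfk : f h ** f k = f k ** f h by rewrite -!homM ck.
  have fhk : f h ** f h = f k + f k - f k ** f k by rewrite -!homM hk homB homD.
  have [le _] := unitary_parts_norm (f h) sfh sfk cfk fhk.
  have [->|fh0] := eqVneq (f h) 0; first by rewrite normr0.
  move: le; rewrite norm_selfadjoint_sq// expr2 ger_pMr ?normr_gt0//.
have sa (h : A) : star h = h -> `|f h| <= `|h|.
  move=> sh; apply/ler_addgt0Pr => e e0.
  have c0 : 0 < `|h| + e by rewrite ltr_wpDl.
  have ci : 0 < (`|h| + e)^-1 by rewrite invr_gt0.
  have : `|f ((`|h| + e)^-1 *: h)| <= 1.
    apply: small; first by rewrite starZ sh conj_Creal// gtr0_real.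
    by rewrite normrZ gtr0_norm// mulrC ltr_pdivrMr// mul1r ltrDl.
  by rewrite homZ normrZ gtr0_norm// mulrC ler_pdivrMr// mul1r.
rewrite -(@ler_pXn2r _ 2)// ?nnegrE// -!cstar_identity -homS -homM.
by apply: sa; rewrite starM starK.
Qed.

Lemma hom_cts : continuous f.
Proof.
by apply: (@lipschitz_cts _ _ _ _ 1) => // x y; rewrite -homB mul1r hom_norm_le.
Qed.

(* With y = s / (1 + s^2) for s = a / 8, the element 8 y has norm at most 8 and
   differs from a by y s a. *)
Lemma approx_lift_selfadjoint (a : A) : star a = a -> `|f a| <= 1 ->
  exists2 a', `|a'| <= 8 & `|f a - f a'| <= 8^-1.
Proof.
move=> sa fa1; pose s : A := 8^-1 *: a.
have ss : star s = s.
  by rewrite starZ sa conj_Creal// ger0_real// invr_ge0.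
have as8 : a = 8 *: s by rewrite scalerA divff ?scale1r// pnatr_eq0.
have [y [sy ys y1]] := resolvent_selfadjoint ss.
exists (8 *: y); first by rewrite normrZ ger0_norm// ler_piMr.
(* The difference becomes $8 f(y s^2)$, of norm at most $8 \cdot 1 \cdot (1/8)^2$. *)
rewrite -homB as8 -scalerBr -{1}ys addrC addKr homZ !homM.
have fs : `|f s| <= 8^-1.
  by rewrite homZ normrZ ger0_norm ?invr_ge0// ler_piMr// invr_ge0.
rewrite normrZ ger0_norm//.
rewrite -ler_pdivlMl//; apply: le_trans (cnormM _ _) _.
rewrite -[leRHS]mul1r; apply: ler_pM => //.
  by apply: le_trans y1; exact: hom_norm_le.
by apply: le_trans (cnormM _ _) _; apply: ler_pM.
Qed.

(** After scaling to [|f a| = 1], the self-adjoint case is applied to the real and imaginary parts,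
    each with bound 8 and error 1/8. The bound on [a'] involves only [f a], as a quotient norm
    would. *)
Lemma approx_lift (a : A) :
  exists2 a', `|a'| <= 16 * `|f a| & `|f a - f a'| <= 4^-1 * `|f a|.
Proof.
wlog fa1 : a / `|f a| = 1.
  move=> W; have [fa0|fa0] := eqVneq (f a) 0.
    by exists 0; rewrite ?hom0 fa0 ?subr0 !normr0 mulr0.
  have n0 : 0 < `|f a| by rewrite normr_gt0.
  have [|a' a1 a2] := W (`|f a|^-1 *: a).
    by rewrite homZ normrZ normfV normr_id mulVf ?gt_eqF.
  have n1 : `|f (`|f a|^-1 *: a)| = 1.
    by rewrite homZ normrZ normfV normr_id mulVf ?gt_eqF.
  exists (`|f a| *: a').
    by rewrite normrZ normr_id mulrC ler_pM2r//; move: a1; rewrite n1 mulr1.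
  have -> : f a - f (`|f a| *: a') =
      `|f a| *: (f (`|f a|^-1 *: a) - f a').
    by rewrite scalerBr !homZ scalerA divff ?scale1r ?gt_eqF.
  by rewrite normrZ normr_id mulrC ler_pM2r//; move: a2; rewrite n1 mulr1.
rewrite fa1 !mulr1.
have [i [ii ci i1]] := imaginary_unit R.
have [x [y [sx sy axy]]] : exists x y, [/\ star x = x, star y = y &
    a = x + i *: y].
  exists (2^-1 *: (a + star a)), (2^-1 *: (i *: (star a - a))).
  have h2 : (2^-1 : R[i])^* = 2^-1 by rewrite conj_Creal// ger0_real// invr_ge0.
  split.
  - by rewrite starZ h2 starD starK addrC.
  - by rewrite starZ h2 starZ ci starB starK scaleNr -scalerN opprB.
  - have iih (t : A) : i *: (2^-1 *: (i *: t)) = - (2^-1 *: t).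
      by rewrite !scalerA mulrAC ii mulN1r scaleNr.
    by rewrite iih -scalerN opprB -scalerDr addrACA subrr addr0 half_double.
have fx1 : `|f x| <= 1.
  have -> : f x = 2^-1 *: (f a + star (f a)).
    rewrite -homS -homD -homZ; congr f.
    rewrite axy starD starZ sx sy ci scaleNr.
    by rewrite addrACA subrr addr0 half_double.
  rewrite normrZ ger0_norm ?invr_ge0// ler_pdivrMl// mulr1.
  by apply: le_trans (ler_normD _ _) _; rewrite norm_star fa1.
have fy1 : `|f y| <= 1.
  have <- : 2^-1 *: (i *: (star (f a) - f a)) = f y.
    rewrite -homS -homB -!homZ; congr f.
    rewrite axy starD starZ sx sy ci scaleNr.
    rewrite opprD addrACA subrr add0r -opprD scalerN scalerDr scalerA ii.
    by rewrite scaleN1r -opprD opprK half_double.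
  rewrite !normrZ i1 mul1r ger0_norm ?invr_ge0// ler_pdivrMl// mulr1.
  by apply: le_trans (ler_normB _ _) _; rewrite norm_star fa1.
have [x' x'8 xx'] := approx_lift_selfadjoint sx fx1.
have [y' y'8 yy'] := approx_lift_selfadjoint sy fy1.
exists (x' + i *: y').
  apply: le_trans (ler_normD _ _) _; rewrite normrZ i1 mul1r.
  by apply: le_trans (lerD x'8 y'8) _; rewrite -natrD.
have -> : f a - f (x' + i *: y') = (f x - f x') + i *: (f y - f y').
  by rewrite axy !homD !homZ opprD addrACA scalerBr.
apply: le_trans (ler_normD _ _) _; rewrite normrZ i1 mul1r.
apply: le_trans (lerD xx' yy') _; rewrite le_eqVlt; apply/orP; left; apply/eqP.
by field.
Qed.

(** An approximate preimage of [b] is corrected repeatedly; the error halves each time and the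
    corrections form a geometric series. *)
Lemma range_closed : closed (range f).
Proof.
move=> b /dist_closure fb.
(* The conditions stand under the existential so that [choice] gives a function of all pairs. The
   constants are $18 = 16 (1/8 + 1)$ and $1/8 + (1/4)(1/8 + 1) = 13/32 \le 1/2$. *)
have step (ce : A * R[i]) : exists c', 0 < ce.2 -> `|b - f ce.1| <= ce.2 ->
    `|c' - ce.1| <= 18 * ce.2 /\ `|b - f c'| <= ce.2 / 2.
  case: ce => c e /=.
  have [e0|e0] := pselect (0 < e); last by exists c.
  have e8 : 0 < e / 8 by rewrite divr_gt0.
  have [_ [d _ <-] /ltW bd] := fb _ e8.
  have [d' d1 d2] := approx_lift (d - c).
  exists (c + d') => _ bc.
  have dc : `|f (d - c)| <= e / 8 + e.
    rewrite homB -(subrKA b); apply: le_trans (ler_normD _ _) _.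
    by rewrite distrC lerD.
  split.
    rewrite addrAC subrr add0r; apply: le_trans d1 _.
    have -> : 18 * e = 16 * (e / 8 + e) by field.
    by rewrite ler_pM2l.
  have -> : b - f (c + d') = (b - f d) + (f (d - c) - f d').
    by rewrite homB homD -(addrA (f d)) -opprD subrKA.
  apply: le_trans (ler_normD _ _) _; apply: le_trans (lerD bd d2) _.
  apply: (@le_trans _ _ (e / 8 + 4^-1 * (e / 8 + e))).
    by rewrite lerD2l ler_pM2l// invr_gt0.
  have -> : e / 2 = e / 8 + 4^-1 * (e / 8 + e) + e * (3 / 32) by field.
  by rewrite lerDl mulr_ge0 ?divr_ge0// ltW.
have [st stP] := choice step.
have [_ [c0 _ <-] /ltW bc0] := fb _ ltr01.
pose u := fix u n := if n is m.+1 then st (u m, 2^-1 ^+ m) else c0.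
have e0 n : 0 < 2^-1 ^+ n :> R[i] by rewrite exprn_gt0// invr_gt0.
have bu n : `|b - f (u n)| <= 2^-1 ^+ n.
  elim: n => [|n IH]; first by rewrite expr0.
  by rewrite exprSr; exact: (stP (u n, _) (e0 n) IH).2.
have uS n : `|u n.+1 - u n| <= 18 * 2^-1 ^+ n.
  exact: (stP (u n, _) (e0 n) (bu n)).1.
have h01 : 0 <= (2^-1 : R[i]) < 1.
  apply/andP; split; first by rewrite invr_ge0.
  by rewrite -[ltLHS]mul1r ltr_pdivrMr// mul1r ltr1n.
have /cvg_ex[x ux] := geometric_cvg h01 uS.
exists x => //; apply: (@cvg_unique B (@norm_hausdorff _ B) (f \o u @ \oo)).
  exact: (continuous_cvg _ (@hom_cts x) ux).
apply/cvgrPdist_lt => e /(expr_small h01)[N HN].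
by exists N => // n /= /HN; exact: le_lt_trans (bu n).
Qed.

End Homs.

End StarHoms.

(** * Positivity *)

Section Positivity.
Variables (R : realType) (A : cstarType R).
Implicit Types (a b d p q v w x : A) (c l t : R[i]).

(* The multiplier 1 + a has norm at most 1. *)
Definition contr a := forall v, `|v + a ** v| <= `|v|.

(* For self-adjoint a, this amounts to the positivity of a. *)
Definition npos a := exists2 c : R[i], 0 < c & contr (- c *: a).

Lemma bernoulli_ge (y : R[i]) n : 0 <= y -> 1 + y *+ n <= (1 + y) ^+ n.
Proof.
move=> y0; elim: n => [|n IH]; first by rewrite addr0.
rewrite exprS mulrDl mul1r mulrS addrCA addrC lerD//.
by rewrite ler_peMr// exprn_ege1// lerDl.
Qed.

(** The map $T = 1 + a$ is symmetric, so $|T^n v|^2 \le |v| |T^{2n} v|$. If $|Tv| > |v|$, the ratios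
    $|T^n v|/|v|$ grow exponentially along powers of 2, against the linear bound. *)
Lemma power_bounded_contr a (M : R[i]) : star a = a -> 0 <= M ->
  (forall n v, `|iter n (fun w => w + a ** w) v| <= (1 + M *+ n) * `|v|) ->
  contr a.
Proof.
move=> sa M0; set T := fun w => w + a ** w => TM v.
have symT n x y : star (iter n T x) ** y = star x ** iter n T y.
  elim: n x y => // n IH x y; rewrite [in RHS]iterSr -IH iterS.
  move: (iter n T x) => u.
  by rewrite /T starD starM sa cmulDl cmulDr cmulA.
pose N n := `|iter n T v|.
have Nsq n : N n ^+ 2 <= N 0%N * N (n + n)%N.
  by rewrite /N -cstar_identity symT -iterD -[X in X * _]norm_star cnormM.
have [v0|v0] := eqVneq (N 0%N) 0.
  by have := TM 1%N v; rewrite -[`|v|]/(N 0%N) v0 mulr0.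
have Np : 0 < N 0%N by rewrite lt_neqAle eq_sym v0 /N normr_ge0.
have N_ge0 n : 0 <= N n by exact: normr_ge0.
have Nr n : N n \is Num.real by rewrite ger0_real// normr_ge0.
rewrite real_leNgt//; apply/negP => N1; have {}N1 : N 0%N < N 1%N := N1.
(* The square root leaves two factors $s^n$ in the lower bound: by Bernoulli one of them absorbs the
   linear growth, so the other would stay bounded. *)
pose s := sqrtC (N 1%N / N 0%N).
have q1 : 1 < N 1%N / N 0%N by rewrite ltr_pdivlMr// mul1r.
have s1 : 1 < s.
  by rewrite -sqrtC1 ltr_sqrtC// ?nnegrE ?ler01// ltW// (lt_trans ltr01).
have s0 : 0 < s by exact: lt_trans s1.
have s2 : s ^+ 2 = N 1%N / N 0%N by rewrite sqrtCK.
have grow k : (s ^+ (2 ^ k)%N) ^+ 2 <= N (2 ^ k)%N / N 0%N.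
  elim: k => [|k IH]; first by rewrite expn0 expr1 s2.
  rewrite expnS mul2n -addnn exprD -expr2.
  apply: (@le_trans _ _ ((N (2 ^ k)%N / N 0%N) ^+ 2)).
    by rewrite lerXn2r ?nnegrE ?exprn_ge0 ?divr_ge0 ?N_ge0 ?(ltW s0).
  rewrite expr2 mulf_div -expr2 ler_pdivrMr ?mulr_gt0// mulrA divfK// mulrC.
  exact: Nsq.
have y0 : 0 < s - 1 by rewrite subr_gt0.
have M1 : 0 < 1 + M by rewrite ltr_wpDr.
have sbd k : s ^+ (2 ^ k)%N <= (1 + M) / (s - 1).
  set n := (2 ^ k)%N; have n0 : (0 < n)%N by rewrite expn_gt0.
  have nR : 0 < n%:R :> R[i] by rewrite ltr0n.
  have sn0 : 0 <= s ^+ n by rewrite exprn_ge0// ltW.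
  rewrite ler_pdivlMr// -(ler_pM2r nR) -mulrA.
  apply: (@le_trans _ _ (s ^+ n * s ^+ n)).
    have := bernoulli_ge n (ltW y0); rewrite (addrC 1 (s - 1)) subrK => sn.
    by rewrite ler_wpM2l// mulr_natr; apply: le_trans sn; rewrite lerDr.
  rewrite -expr2; apply: le_trans (grow k) _; rewrite ler_pdivrMr//.
  apply: le_trans (TM _ _) _; rewrite ler_wpM2r// mulrDl mul1r mulr_natr lerD2r.
  by rewrite ler1n.
have /expr_small : 0 <= s^-1 < 1.
  by rewrite invr_ge0 (ltW s0) -[ltLHS]mul1r ltr_pdivrMr// mul1r.
have e0 : 0 < (s - 1) / (1 + M) by rewrite divr_gt0.
move=> /(_ _ e0)[K /(_ (2 ^ K)%N (ltnW (ltn_expl K (leqnn 2))))].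
rewrite exprVn -[ltRHS]invrK invf_div ltf_pV2 ?posrE.
- by move/lt_le_trans => /(_ _ (sbd K)); rewrite ltxx.
- by rewrite exprn_gt0.
- by rewrite divr_gt0.
Qed.

Lemma contrZ a t : 0 <= t <= 1 -> contr a -> contr (t *: a).
Proof.
move=> /andP[t0 t1] ca v.
have -> : v + t *: a ** v = (1 - t) *: v + t *: (v + a ** v).
  by rewrite scalerDr addrA -scalerDl subrK scale1r cmulZl.
apply: le_trans (ler_normD _ _) _; rewrite !normrZ !ger0_norm ?subr_ge0//.
apply: (@le_trans _ _ ((1 - t) * `|v| + t * `|v|)).
  by rewrite lerD2l ler_wpM2l.
by rewrite -mulrDl subrK mul1r.
Qed.

Lemma contr_avg a b t : 0 <= t <= 1 -> contr a -> contr b ->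
  contr (t *: a + (1 - t) *: b).
Proof.
move=> /andP[t0 t1] ca cb v.
have -> : v + (t *: a + (1 - t) *: b) ** v =
    t *: (v + a ** v) + (1 - t) *: (v + b ** v).
  rewrite !scalerDr addrACA -(scalerDl v) (addrC t (1 - t)) subrK scale1r.
  by rewrite cmulDl !cmulZl.
apply: le_trans (ler_normD _ _) _; rewrite !normrZ !ger0_norm ?subr_ge0//.
apply: (@le_trans _ _ (t * `|v| + (1 - t) * `|v|)).
  by apply: lerD; rewrite ler_wpM2l ?subr_ge0.
by rewrite -mulrDl (addrC t) subrK mul1r.
Qed.

Lemma npos0 : npos 0.
Proof. by exists 1 => // v; rewrite scaler0 cmul0l addr0. Qed.

(** With the scale $cd/(c + d)$, the multiplier for [a + b] is a convex combination of $1 - ca$ and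
    $1 - db$. *)
Lemma nposD a b : npos a -> npos b -> npos (a + b).
Proof.
move=> [c c0 ca] [d d0 db]; have cd : 0 < c + d by rewrite addr_gt0.
exists (c * d / (c + d)); first by rewrite divr_gt0// mulr_gt0.
have -> : - (c * d / (c + d)) *: (a + b) =
    (d / (c + d)) *: (- c *: a) + (1 - d / (c + d)) *: (- d *: b).
  rewrite scalerDr !scalerA; congr (_ *: _ + _ *: _); field; exact: lt0r_neq0.
apply: contr_avg => //; apply/andP; split; first by rewrite divr_ge0// ltW.
by rewrite ler_pdivrMr// mul1r lerDr ltW.
Qed.

Lemma npos_sum (I : Type) (r : seq I) (P : pred I) (F : I -> A) :
  (forall i, P i -> npos (F i)) -> npos (\sum_(i <- r | P i) F i).
Proof. by move=> nF; elim/big_ind: _ => //; [exact: npos0|exact: nposD]. Qed.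

Lemma npos_sq d : star d = d -> npos (d ** d).
Proof.
move=> sd; have d1 : 0 < `|d| + 1 by rewrite ltr_wpDl.
pose e := (`|d| + 1)^-1; have e0 : 0 < e by rewrite invr_gt0.
exists (e ^+ 2) => [|v]; first by rewrite exprn_gt0.
have -> : v + - e ^+ 2 *: (d ** d) ** v = v - (e *: d) ** ((e *: d) ** v).
  by rewrite !(cmulZl, cmulZr) scalerA -expr2 scaleNr cmulA.
apply: norm_sub_sq; first by rewrite starZ sd conj_Creal// gtr0_real.
by rewrite normrZ gtr0_norm// mulrC ltr_pdivrMr// mul1r ltrDl.
Qed.

(* (1 + l x^* x)^n x^* = x^* (1 + l x x^* )^n, so that the powers of
   1 + l x^* x grow at most linearly. *)
Lemma contr_swap x l : l^* = l -> contr (l *: (x ** star x)) ->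
  contr (l *: (star x ** x)).
Proof.
move=> ll cx; pose M := `|l| * `|x| ^+ 2.
apply: (@power_bounded_contr _ M).
- by rewrite starZ ll starM starK.
- by rewrite mulr_ge0// exprn_ge0.
set T := fun w => _; pose T' w := w + l *: (x ** star x) ** w.
have TD n v w : iter n T (v + w) = iter n T v + iter n T w.
  elim: n => //= n ->; rewrite /T cmulDr addrACA//.
have TZ n k w : iter n T (k *: w) = k *: iter n T w.
  by elim: n => //= n ->; rewrite /T cmulZr scalerDr.
have Tx n w : iter n T (star x ** w) = star x ** iter n T' w.
  elim: n => //= n ->; rewrite /T /T' cmulDr !cmulZl cmulZr -!cmulA//.
have T'n n w : `|iter n T' w| <= `|w|.
  by elim: n => //= n; apply: le_trans; exact: cx.
elim=> [|n IH] v; first by rewrite /= addr0 mul1r.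
(* Here $T^{n+1} v = T^n v + l x^* T'^n (x v)$, so each step adds at most $M |v|$. *)
rewrite iterSr {2}/T TD cmulZl TZ -cmulA Tx; apply: le_trans (ler_normD _ _) _.
apply: le_trans (lerD (IH v) (lexx _)) _.
rewrite mulrSr addrA [leRHS]mulrDl lerD2l normrZ /M -mulrA.
rewrite ler_wpM2l// expr2 -mulrA; apply: le_trans (cnormM _ _) _.
rewrite norm_star ler_wpM2l//; apply: le_trans (T'n _ _) _.
exact: cnormM.
Qed.

(* d + d^3 has norm at least 2 |d|^2 since (d + e)^2 = 4 d e + (d - e)^2. *)
Lemma contr_sq_norm d : star d = d -> contr (d ** d) -> `|d| <= 2^-1.
Proof.
move=> sd cd; have [->|d0] := eqVneq d 0; first by rewrite normr0 invr_ge0.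
have dp : 0 < `|d| by rewrite normr_gt0.
pose e := d ** d ** d.
have se : star e = e by rewrite /e !starM sd cmulA.
have de : d ** e = e ** d by rewrite /e !cmulA.
have le2 : `|2 *: (d ** d)| ^+ 2 <= `|d + e| ^+ 2.
  rewrite -(@norm_selfadjoint_sq _ _ (d + e)); last by rewrite starD sd se.
  have -> : (d + e) ** (d + e) =
      (2 *: (d ** d)) ** (2 *: (d ** d)) + (d - e) ** (d - e).
    have aux (x y z : A) :
        x + y + (y + z) = (y + y + (y + y)) + (x - y - (y - z)).
      rewrite (addrC y z) addrACA opprB [X in _ = _ + X]addrACA -opprD.
      by rewrite [RHS]addrC [RHS]addrA subrK.
    rewrite cmulBl !cmulBr cmulDl !cmulDr de aux; congr (_ + _).
    by rewrite cmulZl cmulZr !scaler_nat !mulr2n /e !cmulA.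
  apply: norm_sq_le_sum.
  - by rewrite starZ starM sd conj_Creal// ger0_real.
  - by rewrite starB sd se.
  - by rewrite cmulZl cmulZr cmulBl cmulBr /e !cmulA.
have : 2 * `|d| ^+ 2 <= `|d|.
  apply: le_trans (cd d).
  rewrite -norm_selfadjoint_sq// -[2 * _](_ : `|2 *: (d ** d)| = _).
    by rewrite -(@ler_pXn2r _ 2)// ?nnegrE.
  by rewrite normrZ ger0_norm// norm_selfadjoint_sq.
rewrite expr2 mulrA ger_pMl// => d2.
by rewrite -[leRHS]mulr1 ler_pdivlMl.
Qed.

(** This is $d (1 + T/2)$ with $T = 1 + d^2$. The step enlarges the norm by a factor 3/2 and keeps
    $1 + d^2$ a contraction. *)
Definition growth_step d : A := (3 / 2) *: d + 2^-1 *: (d ** d ** d).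

(* For d' = growth_step d one has
   1 + d'^2 = 3/4 (1 + d^2)^2 + 1/4 (1 + d^2)^3. *)
Lemma growth_stepP d : star d = d -> contr (d ** d) ->
  [/\ star (growth_step d) = growth_step d,
      contr (growth_step d ** growth_step d)
    & 3 / 2 * `|d| <= `|growth_step d| ].
Proof.
move=> sd cd; pose T w := w + d ** d ** w.
have sg : star (growth_step d) = growth_step d.
  rewrite /growth_step starD !starZ !starM sd.
  by rewrite !conj_Creal ?ger0_real ?invr_ge0 ?divr_ge0// cmulA.
have nT w : `|T w| <= `|w| by exact: cd.
have gE w : growth_step d ** w = d ** (w + 2^-1 *: T w).
  have -> : w + 2^-1 *: T w = (3 / 2) *: w + 2^-1 *: (d ** d ** w).
    rewrite /T scalerDr addrA -[X in X + _ + _]scale1r -scalerDl.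
    by congr (_ *: _ + _); field.
  by rewrite /growth_step cmulDl cmulDr !(cmulZl, cmulZr) !cmulA.
have TD v w : T (v + w) = T v + T w by rewrite /T cmulDr addrACA.
have TZ k w : T (k *: w) = k *: T w by rewrite /T cmulZr scalerDr.
have dT w : T (d ** w) = d ** T w by rewrite /T cmulDr !cmulA.
have half_sum w : 2^-1 *: w + 2^-1 *: w = w by rewrite -scalerDr half_double.
split=> //.
  move=> v; have -> : v + growth_step d ** growth_step d ** v =
      (3 / 4) *: T (T v) + 4^-1 *: T (T (T v)).
    have gT w : d ** (d ** w) = T w - w by rewrite /T addrC addKr cmulA.
    have q4 : (2^-1 : R[i]) * 2^-1 = 4^-1 by field.
    rewrite -cmulA !gE dT -cmulZr -cmulDr gT.
    have -> : v + 2^-1 *: T v + 2^-1 *: T (v + 2^-1 *: T v) =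
        v + T v + 4^-1 *: T (T v).
      rewrite TD TZ (scalerDr _ (T v)) scalerA q4 addrA.
      by rewrite -(addrA v (2^-1 *: T v)) half_sum.
    have aux (x a p r c : A) : x + (a + (p + r) + c) = (p + c) + (x + a + r).
      by rewrite [RHS]addrC !addrA (addrAC (x + a) r).
    rewrite (TD (v + T v)) (TD v (T v)) (TZ _ (T (T v))) addrA.
    apply/eqP; rewrite subr_eq.
    rewrite -(aux v (T v) ((3 / 4) *: T (T v)) (4^-1 *: T (T v))) -scalerDl.
    by have -> : (3 / 4 + 4^-1 : R[i]) = 1; [field|rewrite scale1r].
  apply: le_trans (ler_normD _ _) _.
  rewrite !normrZ !ger0_norm ?divr_ge0 ?invr_ge0//.
  apply: (@le_trans _ _ (3 / 4 * `|v| + 4^-1 * `|v|)).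
    apply: lerD; rewrite ler_pM2l ?divr_gt0 ?invr_gt0//.
      by apply: le_trans (nT _) _.
    by do 2! apply: le_trans (nT _) _.
  by rewrite -mulrDl le_eqVlt; apply/orP; left; apply/eqP; field.
have [->|d0] := eqVneq d 0; first by rewrite normr0 mulr0.
have dp : 0 < `|d| by rewrite normr_gt0.
(* It suffices to bound $(3/2) d^2 + (1/2) d^4$ from below. With square roots of the coefficients it
   is a sum of two commuting squares, the first of norm $(3/2) |d|^2$. *)
rewrite -(ler_pM2l dp); apply: le_trans (cnormM _ _).
pose s := sqrtC (3 / 2 : R[i]); have s0 : 0 <= s by rewrite sqrtC_ge0 divr_ge0.
pose r := sqrtC (2^-1 : R[i]); have r0 : 0 <= r by rewrite sqrtC_ge0 invr_ge0.
have s2 : s * s = 3 / 2 by rewrite -expr2 sqrtCK.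
have r2 : r * r = 2^-1 by rewrite -expr2 sqrtCK.
have -> : d ** growth_step d =
    (s *: d) ** (s *: d) + (r *: (d ** d)) ** (r *: (d ** d)).
  by rewrite /growth_step cmulDr !(cmulZl, cmulZr) !scalerA s2 r2 !cmulA.
apply: le_trans (norm_sq_le_sum _ _ _).
- by rewrite normrZ ger0_norm// exprMn (expr2 s) s2 mulrCA -expr2.
- by rewrite starZ sd conj_Creal// ger0_real.
- by rewrite starZ starM sd conj_Creal// ger0_real.
- by rewrite !(cmulZl, cmulZr) !scalerA mulrC cmulA.
Qed.

(** Iterating [growth_step] from a nonzero [d] would exceed the bound 1/2 of [contr_sq_norm]. *)
Lemma contr_sq_eq0 d : star d = d -> contr (d ** d) -> d = 0.
Proof.
move=> sd cd; apply/eqP; apply: contraT => d0.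
have dp : 0 < `|d| by rewrite normr_gt0.
have it n : [/\ star (iter n growth_step d) = iter n growth_step d,
    contr (iter n growth_step d ** iter n growth_step d)
  & (3 / 2) ^+ n * `|d| <= `|iter n growth_step d| ].
  elim: n => [|n [sn cn len]]; first by rewrite mul1r.
  have [sn' cn' len'] := growth_stepP sn cn; split=> //.
  rewrite exprS -mulrA; apply: le_trans len'.
  by rewrite ler_pM2l// divr_gt0.
have r01 : 0 <= (2 / 3 : R[i]) < 1.
  apply/andP; split; first by rewrite divr_ge0.
  by rewrite ltr_pdivrMr// mul1r ltr_nat.
have e0 : 0 < 2 * `|d| by rewrite mulr_gt0.
have [N /(_ N (leqnn N))] := expr_small r01 e0.
have [sn cn len] := it N.
have := le_trans len (contr_sq_norm sn cn).
have p0 : 0 < (3 / 2 : R[i]) ^+ N by rewrite exprn_gt0// divr_gt0.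
rewrite -[2 / 3]invf_div exprVn mulrC -ler_pdivlMr// => dle /lt_le_trans.
move=> /(_ (2 * (2^-1 / (3 / 2) ^+ N))); rewrite ler_pM2l// => /(_ dle).
by rewrite mulrA divff ?pnatr_eq0// mul1r ltxx.
Qed.

(** At the common scale $e = cd/(c + d)$, below both [c] and [d], the multipliers $1 \pm b$ with $b
    = ea$ are contractions. Hence so is $1 + b^2$, the mean of their squares. *)
Lemma npos_antisym a : star a = a -> npos a -> npos (- a) -> a = 0.
Proof.
move=> sa [c c0 ca] [d d0 da].
have cd : 0 < c + d by rewrite addr_gt0.
pose e := c * d / (c + d); have e0 : 0 < e by rewrite divr_gt0// mulr_gt0.
have c1 : contr (- (e *: a)).
  have -> : - (e *: a) = (d / (c + d)) *: (- c *: a).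
    by rewrite scalerA mulrN scaleNr; congr (- (_ *: _)); rewrite /e; ring.
  apply: contrZ => //; apply/andP; split; first by rewrite divr_ge0// ltW.
  by rewrite ler_pdivrMr// mul1r lerDr ltW.
have c2 : contr (e *: a).
  have -> : e *: a = (c / (c + d)) *: (- d *: - a).
    by rewrite scalerN scaleNr opprK scalerA; congr (_ *: _); rewrite /e; ring.
  apply: contrZ => //; apply/andP; split; first by rewrite divr_ge0// ltW.
  by rewrite ler_pdivrMr// mul1r lerDl ltW.
suff : e *: a = 0.
  by move/eqP; rewrite scaler_eq0 gt_eqF//= => /eqP.
set b := e *: a in c1 c2 *.
apply: contr_sq_eq0; first by rewrite /b starZ sa conj_Creal// gtr0_real.
move=> v; pose T w := w + b ** w; pose T' w := w + - b ** w.
have -> : v + b ** b ** v = 2^-1 *: (T (T v) + T' (T' v)).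
  rewrite /T /T' !cmulDr !cmulNl !cmulNr opprK cmulA.
  set x := b ** v; set y := b ** b ** v.
  rewrite addrACA (addrACA v x) subrr addr0 (addrACA x y) subrr add0r.
  by rewrite addrACA half_double.
rewrite normrZ ger0_norm ?invr_ge0// ler_pdivrMl// mulr_natl mulr2n.
apply: le_trans (ler_normD _ _) _.
by apply: lerD;
  [exact: le_trans (c2 (T v)) (c2 v)|exact: le_trans (c1 (T' v)) (c1 v)].
Qed.

(* If v^* v <= 0 then v v^* <= 0 as well, whereas v v^* + v^* v is a sum of
   squares of self-adjoint elements. *)
Lemma npos_opp_starM_eq0 v : npos (- (star v ** v)) -> v = 0.
Proof.
move=> nv; suff v0 : v ** star v = 0.
  apply/eqP; rewrite -normr_eq0 -norm_star -sqrf_eq0 -cstar_identity.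
  by rewrite starK v0 normr0.
apply: npos_antisym; first by rewrite starM starK.
  have [i [ii ci i1]] := imaginary_unit R.
  (* Up to the sign of [k], these are the real and imaginary parts of [v], and $v v^* + v^* v = 2h^2
     + 2k^2$. *)
  pose h := 2^-1 *: (v + star v); pose k := 2^-1 *: (i *: (v - star v)).
  have h2 : (2^-1 : R[i])^* = 2^-1 by rewrite conj_Creal// ger0_real// invr_ge0.
  have sh : star h = h by rewrite /h starZ h2 starD starK addrC.
  have sk : star k = k.
    by rewrite /k !starZ h2 ci starB starK scaleNr -scalerN opprB.
  have -> : v ** star v =
      h ** h + h ** h + (k ** k + k ** k) + - (star v ** v).
    have half_sq (t : A) : (2^-1 *: t) ** (2^-1 *: t) +
        (2^-1 *: t) ** (2^-1 *: t) = 2^-1 *: (t ** t).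
      by rewrite !(cmulZl, cmulZr) -scalerDr half_double.
    have aux (x y z w : A) :
        x + y + (z + w) - (x - y - (z - w)) = (y + z) + (y + z).
      have -> : x - y - (z - w) = x + w - (y + z).
        by rewrite (opprB z) addrACA -opprD.
      by rewrite (addrC z w) (addrACA x y) opprB [LHS]addrC subrKA.
    have iie (t : A) : i *: (i *: t) = - t by rewrite scalerA ii scaleN1r.
    rewrite /h /k !half_sq !(cmulZl, cmulZr) iie -scalerDr.
    by rewrite cmulBl !cmulBr cmulDl !cmulDr aux half_double addrK.
  by apply: nposD => //; apply: nposD; apply: nposD; apply: npos_sq.
case: nv => c c0 cv; exists c => //.
rewrite scalerN scaleNr opprK -[v in v ** _]starK; apply: contr_swap.
  by rewrite conj_Creal// gtr0_real.
by rewrite starK; move: cv; rewrite scalerN scaleNr opprK.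
Qed.

(** The negative of each term is the sum of the remaining ones, so [npos_opp_starM_eq0] applies,
    first to [v] and then to each [x i]. *)
Lemma npos_starM_sum_eq0 (I : finType) (P : pred I) (x : I -> A) v :
  (forall i, P i -> npos (star (x i) ** x i)) ->
  star v ** v + \sum_(i | P i) star (x i) ** x i = 0 ->
  v = 0 /\ forall i, P i -> x i = 0.
Proof.
move=> nx sum0; have v0 : v = 0.
  apply: npos_opp_starM_eq0; have -> : - (star v ** v) =
      \sum_(i | P i) star (x i) ** x i.
    by apply/eqP; rewrite eq_sym -addr_eq0 addrC sum0.
  exact: npos_sum.
split=> // i Pi; apply: npos_opp_starM_eq0.
move: sum0; rewrite v0 cmul0r add0r (bigD1 i)//= => sum0.
have -> : - (star (x i) ** x i) = \sum_(j | P j && (j != i)) star (x j) ** x j.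
  by apply/eqP; rewrite eq_sym -addr_eq0 addrC sum0.
by apply: npos_sum => j /andP[Pj _]; exact: nx.
Qed.

(** Multiplication by $1 - 2q$ is isometric, and $q$ and $1 - q$ are $(1 \mp (1 - 2q))/2$. *)
Lemma projection_norm q v : is_projection q ->
  `|q ** v| <= `|v| /\ `|v - q ** v| <= `|v|.
Proof.
move=> [qq sq]; have U : `|v - 2 *: (q ** v)| = `|v|.
  apply/eqP; rewrite -(@eqrXn2 _ 2)// -!cstar_identity; apply/eqP; congr `|_|.
  rewrite scaler_nat mulr2n starB starD !starM sq cmulBl cmulDl !cmulBr !cmulDr.
  rewrite !cmulA -(cmulA _ q q) qq.
  set x := star v ** v; set y := star v ** q ** v.
  have -> : y - (y + y) = - y by rewrite opprD addrA subrr sub0r.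
  by rewrite -opprD opprK subrK.
have le2 (w : A) : w + w = v + (v - 2 *: (q ** v)) \/
    w + w = v - (v - 2 *: (q ** v)) -> `|w| <= `|v|.
  move=> wE; rewrite -(half_double w) normrZ ger0_norm ?invr_ge0// ler_pdivrMl//.
  rewrite mulr_natl mulr2n; case: wE => ->.
    by apply: le_trans (ler_normD _ _) _; rewrite U.
  by apply: le_trans (ler_normB _ _) _; rewrite U.
split; apply: le2; [right|left]; rewrite scaler_nat mulr2n.
  by rewrite opprB [RHS]addrC addrNK.
by rewrite opprD addrACA [RHS]addrA.
Qed.

(* 1 - b = (1 - F) + F (1 - q) F has bounded powers. *)
Lemma npos_compression q b (F : A -> A) : is_projection q -> star b = b ->
  (forall v w, F (v + w) = F v + F w) -> (forall v, F (F v) = F v) ->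
  (forall v, `|F v| <= `|v|) -> (forall v, `|v - F v| <= `|v|) ->
  (forall v, b ** v = F (q ** F v)) -> npos b.
Proof.
move=> pq sb FD FF Fle F'le bF; exists 1 => //; rewrite scaleN1r.
apply: (@power_bounded_contr _ 1) => //; first by rewrite starN sb.
set T := fun w => _.
have FN v : F (- v) = - F v.
  have F0 : F 0 = 0 by apply: (addIr (F 0)); rewrite -FD !add0r.
  by apply: (addIr (F v)); rewrite -FD !addNr F0.
(* On the range of [F] the iteration is the compression [Y] of $1 - q$, a contraction; on the
   complement it is the identity. *)
pose Y w := F (w - q ** w).
have TY n v : iter n T v = (v - F v) + iter n Y (F v).
  elim: n => [|n IH]; first by rewrite /= subrK.
  rewrite iterS IH; set u := iter n Y (F v).
  have Fu : F u = u by rewrite /u; case: n {IH u} => //= n; exact: FF.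
  have Fv : F (v - F v) = 0 by rewrite FD FN FF subrr.
  rewrite /T cmulNl bF FD Fv add0r Fu -addrA; congr (_ + _).
  by rewrite iterS -/u /Y FD FN Fu.
have Yle n v : `|iter n Y v| <= `|v|.
  elim: n => //= n; apply: le_trans; apply: le_trans (Fle _) _.
  exact: (projection_norm _ pq).2.
move=> [|n] v; first by rewrite addr0 mul1r.
apply: (@le_trans _ _ (`|v| + `|v|)).
  rewrite TY; apply: le_trans (ler_normD _ _) _; apply: lerD => //.
  by apply: le_trans (Yle _ _) _.
rewrite mulrDl mul1r lerD2l ler_peMl// ler1n//.
Qed.

End Positivity.

(** * Functions on the path space *)

#[local] Arguments ev : simpl never.

Section PathFunctions.
Variables (R : realType) (E : digraph).
Local Notation C := (C_infpath R E).
Implicit Types (a b x y : C) (z w : infpath E) (e f : edge E) (v : vertex E).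

Definition chiv v : C := chi R (cylinders_vertex v).
Definition chie e : C := chi R (cylinders_edge e).

Lemma evD a b z : ev (a + b) z = ev a z + ev b z. Proof. by []. Qed.
Lemma evZ (k : R[i]) a z : ev (k *: a) z = k * ev a z. Proof. by []. Qed.
Lemma evM a b z : ev (a ** b) z = ev a z * ev b z. Proof. by []. Qed.
Lemma evS a z : ev (star a) z = (ev a z)^*. Proof. by []. Qed.
Lemma ev0 z : ev (0 : C) z = 0. Proof. by []. Qed.

Lemma ev_sum (I : Type) (r : seq I) (P : pred I) (F : I -> C) z :
  ev (\sum_(i <- r | P i) F i) z = \sum_(i <- r | P i) ev (F i) z.
Proof. by apply: (big_morph (fun a => ev a z)). Qed.

Lemma ev_chiv v z : ev (chiv v) z = (infpath_rng z == v)%:R.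
Proof.
change (ev (chiv v) z) with ((`[< infpath_rng z = v >])%:R : R[i]).
by congr (_%:R); congr nat_of_bool; apply/asboolP/eqP.
Qed.

Lemma ev_chie e z : ev (chie e) z = (z 0%N == e)%:R.
Proof.
change (ev (chie e) z) with ((`[< [:: z 0%N] = [:: e] >])%:R : R[i]).
by congr (_%:R); congr nat_of_bool; apply/asboolP/eqP => [[]|->].
Qed.

Lemma ev_ract x b z : ev (X_ract x b) z = ev x z * ev b (Defs.shift z).
Proof. by []. Qed.

Lemma ev_lact x b z : ev (X_lact x b) z = ev x z * ev b z.
Proof. by []. Qed.

Lemma comp_prepend_cts e a : continuous (fun z => ev a (prepend e z) : R[i]^o).
Proof.
move=> z.
exact: (continuous_comp (@prepend_continuous E e z)
  (@ev_cts R E a (prepend e z))).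
Qed.

(* z |-> a(ez), extended by 0 to the paths z with r(z) <> s(e). *)
Definition pull e a : C := chiv (src e) ** mkC (@comp_prepend_cts e a).

Lemma ev_pull e a z :
  ev (pull e a) z = if src e == infpath_rng z then ev a (prepend e z) else 0.
Proof.
rewrite evM ev_chiv eq_sym; case: eqP => _; last by rewrite mul0r.
by rewrite mul1r.
Qed.

Lemma prepend0 e z : src e = infpath_rng z -> prepend e z 0%N = e.
Proof. by move=> /prependE ->. Qed.

Lemma rng_prepend e z :
  src e = infpath_rng z -> infpath_rng (prepend e z) = rng e.
Proof. by move=> ez; rewrite /infpath_rng prepend0. Qed.

Lemma pull_linear e : linear (pull e).
Proof.
by move=> k a b; apply: Cext => z; rewrite evD evZ !ev_pull evD evZ; case: ifP;
  rewrite ?mulr0 ?addr0.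
Qed.

Lemma pullM e a b : pull e (a ** b) = pull e a ** pull e b.
Proof.
by apply: Cext => z; rewrite evM !ev_pull evM; case: ifP; rewrite ?mulr0.
Qed.

Lemma pullS e a : pull e (star a) = star (pull e a).
Proof.
by apply: Cext => z; rewrite evS !ev_pull evS; case: ifP; rewrite ?conjC0.
Qed.

Lemma chiv_pull e a : chiv (src e) ** pull e a = pull e a.
Proof.
by apply: Cext => z; rewrite evM ev_chiv eq_sym ev_pull; case: ifP;
  rewrite ?mul1r ?mul0r.
Qed.

Lemma pull_chiv e v : pull e (chiv v) = if rng e == v then chiv (src e) else 0.
Proof.
apply: Cext => z; rewrite ev_pull ev_chiv.
case: eqP => [ez|ez].
  by rewrite rng_prepend//; case: ifP; rewrite ?ev0// ev_chiv ez eqxx.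
case: ifP => _; last by rewrite ev0.
by rewrite ev_chiv; case: eqP => // ze; case: ez; rewrite ze.
Qed.

Lemma pull_ract_chie f e a :
  pull f (X_ract (chie e) a) = if f == e then chiv (src e) ** a else 0.
Proof.
apply: Cext => z; rewrite ev_pull ev_ract ev_chie.
case: eqP => [fz|fz]; last first.
  case: ifP => [/eqP fe|]; last by rewrite ev0.
  by rewrite evM ev_chiv -fe; case: eqP => [/esym//|]; rewrite mul0r.
rewrite prepend0// shift_prepend//; case: eqP => [fe|]; last by rewrite mul0r.
by rewrite evM ev_chiv -fe fz eqxx.
Qed.

Lemma pull_chie f e : pull f (chie e) = if f == e then chiv (src e) else 0.
Proof.
apply: Cext => z; rewrite ev_pull ev_chie; case: eqP => [fz|fz].
  rewrite prepend0//; case: eqP => [<-|]; last by rewrite ev0.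
  by rewrite ev_chiv fz eqxx.
case: eqP => [fe|]; last by rewrite ev0.
by rewrite ev_chiv -fe; case: eqP => // zf; case: fz; rewrite zf.
Qed.

Lemma pull_lact f a x : pull f (X_lact a x) = pull f a ** pull f x.
Proof.
by apply: Cext => z; rewrite evM !ev_pull ev_lact; case: ifP; rewrite ?mulr0.
Qed.

Lemma pull_ract f x b : pull f (X_ract x b) = pull f x ** b.
Proof.
apply: Cext => z; rewrite evM !ev_pull ev_ract.
case: eqP => [fz|]; last by rewrite mul0r.
by rewrite shift_prepend.
Qed.

Lemma X_ip_pull x y : X_ip x y = \sum_e star (pull e x) ** pull e y.
Proof.
apply: Cext => z; rewrite X_ipE ev_sum [LHS]big_mkcond; apply: eq_bigr => e _.
by rewrite evM evS !ev_pull; case: ifP => //; rewrite mulr0.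
Qed.

(** Every path has exactly one first edge, so the functions $\chi_{Z(e)}$ form a finite frame of the
    module. *)
Lemma chie_decomp x : x = \sum_e X_ract (chie e) (pull e x).
Proof.
apply: Cext => z; rewrite ev_sum (bigD1 (z 0%N))//= big1 ?addr0 => [|e ez].
  rewrite ev_ract ev_chie eqxx mul1r ev_pull.
  have -> : src (z 0%N) == infpath_rng (Defs.shift z).
    by apply/eqP; exact: (infpathP z 0%N).
  by rewrite prepend_shift.
by rewrite ev_ract ev_chie eq_sym (negbTE ez) mul0r.
Qed.

Lemma chiv_orthogonal v (u : vertex E) :
  chiv v ** chiv u = if v == u then chiv v else 0.
Proof.
apply: Cext => z; rewrite evM !ev_chiv; case: (eqVneq v u) => [->|vu].
  by rewrite ev_chiv -natrM mulnb andbb.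
case: eqP => [->|]; last by rewrite mul0r ev0.
by rewrite (negbTE vu) mulr0 ev0.
Qed.

Lemma cmul_chivC a v : a ** chiv v = chiv v ** a.
Proof. by apply: Cext => z; rewrite !evM mulrC. Qed.

Lemma star_chiv v : star (chiv v) = chiv v.
Proof. by apply: Cext => z; rewrite evS !ev_chiv conjC_nat. Qed.

Lemma ev_sum_chiv z : ev (\sum_v chiv v) z = 1.
Proof.
rewrite ev_sum (bigD1 (infpath_rng z))//= ev_chiv eqxx big1 ?addr0// => v vz.
by rewrite ev_chiv eq_sym (negbTE vz).
Qed.

Lemma chie_ract_src e : X_ract (chie e) (chiv (src e)) = chie e.
Proof.
apply: Cext => z; rewrite ev_ract ev_chie ev_chiv.
case: eqP => [<-|]; last by rewrite mul0r.
have -> : infpath_rng (Defs.shift z) = src (z 0%N) by rewrite (infpathP z 0%N).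
by rewrite eqxx mulr1.
Qed.

Lemma lact_chie_rng e : X_lact (chiv (rng e)) (chie e) = chie e.
Proof.
apply: Cext => z; rewrite ev_lact ev_chie ev_chiv /infpath_rng.
by case: (z 0%N =P e) => [->|]; rewrite ?mulr0// eqxx mul1r.
Qed.

Lemma sum_chiv_mul a : (\sum_v chiv v) ** a = a.
Proof. by apply: Cext => z; rewrite evM ev_sum_chiv mul1r. Qed.

Lemma X_ip_chie e f :
  X_ip (chie e) (chie f) = if e == f then chiv (src e) else 0.
Proof.
apply: Cext => z; rewrite X_ipE; case: (eqVneq e f) => [<-|ef]; last first.
  rewrite big1// => g /eqP gz; rewrite !ev_chie prepend0//.
  by case: eqP => [->|]; rewrite ?(negbTE ef) ?mulr0// conjC0 mul0r.
rewrite ev_chiv big_mkcond (bigD1 e)//= big1 ?addr0.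
  case: eqP => [ez|ez]; last by case: eqP => // /esym.
  by rewrite ev_chie prepend0// eqxx ez eqxx conjC1 mulr1.
move=> g ge; case: eqP => // gz.
by rewrite ev_chie prepend0// (negbTE ge) conjC0 mul0r.
Qed.

(** The frame shows that the left action is by finite-rank operators, so the Cuntz-Pimsner relation
    is imposed for every [a]. *)
Lemma lact_theta a x : X_lact a x =
  \sum_e X_ract (X_ract (chie e) (pull e a)) (X_ip (chie e) x).
Proof.
rewrite [LHS]chie_decomp; apply: eq_bigr => e _.
rewrite -X_ractM pull_lact; congr X_ract; congr (_ ** _).
apply: Cext => z; rewrite ev_pull X_ipE big_mkcond (bigD1 e)//= big1 ?addr0.
  by case: eqP => // ez; rewrite ev_chie prepend0// eqxx conjC1 mul1r.
move=> f fe; case: eqP => // fz.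
by rewrite ev_chie prepend0// (negbTE fe) conjC0 mul0r.
Qed.

(** Local constancy at depth [n]. The range is compared separately so that depth 0 means dependence
    on the range vertex alone. *)
Definition depends n a := forall z w, infpath_rng w = infpath_rng z ->
  agree n z w -> ev a w = ev a z.

(** Uniform continuity by compactness: counterexamples for all [n] would have a cluster point, near
    which [a] varies by less than [d]. *)
Lemma uniform_agree a (d : R[i]) : 0 < d ->
  exists n, forall z w, agree n z w -> `|ev a z - ev a w| < d.
Proof.
move=> d0; apply: contrapT => nex.
have bad n : exists zw : infpath E * infpath E,
    agree n zw.1 zw.2 /\ ~ `|ev a zw.1 - ev a zw.2| < d.
  apply: contrapT => nbad; apply: nex; exists n => z w zw.
  by apply: contrapT => ?; apply: nbad; exists (z, w).
have [u uP] := choice bad.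
pose F : set_system (infpath E) := (fun n => (u n).1) @ \oo.
have FF : ProperFilter F by exact: fmap_proper_filter.
have [z [_ zF]] := infpath_compact FF filterT.
have d20 : 0 < d / 2 by rewrite divr_gt0.
have [m zm] : exists m, forall w, agree m z w -> `|ev a z - ev a w| < d / 2.
  apply/nbhs_agreeP; move/cvgrPdist_lt : (@ev_cts R E a z); exact.
have [||w [[n mn <-] zw]] := zF [set (u n).1 | n in [set n | (m <= n)%N]]
    [set w | agree m z w].
- by exists m => // n /= mn; exists n.
- by apply/nbhs_agreeP; exists m.
have [uu nu] := uP n; apply: nu.
rewrite [d]splitr; apply: le_lt_trans (ler_distD (ev a z) _ _) _.
apply: ltrD; first by rewrite distrC; exact: zm.
apply: zm => i im; rewrite uu ?zw//; exact: leq_trans mn.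
Qed.

Lemma depends_dense a (d : R[i]) : 0 < d ->
  exists2 b, exists n, depends n b & `|a - b| <= d.
Proof.
move=> d0; have [n an] := uniform_agree a d0.
have /choice[r rP] : forall s : seq (edge E), exists o : option (infpath E),
    if o is Some z then mkseq z n = s else forall z : infpath E, mkseq z n <> s.
  move=> s.
  have [[z zs]|nz] := pselect (exists z : infpath E, mkseq z n = s).
    by exists (Some z).
  by exists None => z zs; apply: nz; exists z.
(* On each cylinder of depth [n], [b] is the value of [a] at a chosen path. The default 0 is never
   taken, since [z] itself has the prefix [mkseq z n]. *)
pose b z : R[i]^o := if r (mkseq z n) is Some w then ev a w else 0.
have bE z w : agree n z w -> b w = b z.
  move=> zw; rewrite /b (_ : mkseq w n = mkseq z n)//; apply/eq_in_map => i.
  by rewrite mem_iota => /andP[_ ilt]; exact: zw.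
have bc : continuous b.
  move=> z B Bz; apply/nbhs_agreeP; exists n => w /bE bw.
  by rewrite /preimage /= bw; exact: nbhs_singleton Bz.
exists (mkC bc); first by exists n => z w _ /bE.
apply: ev_norm_le => [|z]; first exact: ltW.
change (`|ev a z - b z| <= d); rewrite /b; have := rP (mkseq z n).
case: (r _) => [w wz|/(_ z)//]; rewrite distrC; apply: ltW; apply: an.
by apply/cyl_agree; rewrite /cyl /= size_mkseq.
Qed.

(** Induction over the depth of locally constant functions, followed by density. It serves both for
    the convergence of [approx_rep] and for surjectivity onto $O(X(E^\infty))$. *)
Lemma C_infpath_ind (D : set C) : closed D -> D 0 ->
  (forall (k : R[i]) a b, D a -> D b -> D (k *: a + b)) ->
  (forall v, D (chiv v)) -> (forall e a, D a -> D (X_ract (chie e) a)) ->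
  forall a, D a.
Proof.
move=> cD D0 Dl Dv De a.
have Dsum (I : Type) (r : seq I) (F : I -> C) :
    (forall i, D (F i)) -> D (\sum_(i <- r) F i).
  move=> DF; elim/big_rec: _ => // i x _ Dx.
  by rewrite -[F i]scale1r; exact: Dl.
have dep n : forall b, depends n b -> D b.
  elim: n => [b b0|n IH b bn].
    have /choice[c cP] : forall v, exists c : R[i],
        forall z, infpath_rng z = v -> ev b z = c.
      move=> v; have [[w wv]|nw] := pselect (exists w, infpath_rng w = v).
        by exists (ev b w) => z zv; apply: b0 => //; rewrite zv wv.
      by exists 0 => z zv; case: nw; exists z.
    have -> : b = \sum_v c v *: chiv v.
      apply: Cext => z; rewrite ev_sum (bigD1 (infpath_rng z))//= big1 ?addr0.
        by rewrite evZ ev_chiv eqxx mulr1; exact: cP.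
      by move=> v vz; rewrite evZ ev_chiv eq_sym (negbTE vz) mulr0.
    by apply: Dsum => v; rewrite -[_ *: _]addr0; exact: Dl.
  (* Pulling back along an edge lowers the depth by one. *)
  rewrite (chie_decomp b); apply: Dsum => e; apply: De; apply: IH => z w wz zw.
  rewrite !ev_pull wz; case: eqP => // ez; apply: bn.
    by rewrite !rng_prepend// wz.
  by move=> [|i] ilt; rewrite !prependE ?wz//=; exact: zw.
apply: cD; apply/dist_closure => d d0.
have d20 : 0 < d / 2 by rewrite divr_gt0.
have [b [n /dep Db] ab] := depends_dense a d20; exists b => //.
by apply: le_lt_trans ab _; rewrite ltr_pdivrMr// mulr_natr mulr2n ltrDl.
Qed.

End PathFunctions.

(** * Toeplitz-Cuntz-Krieger families *)

Section Families.
Variables (R : realType) (E : digraph) (B : cstarType R).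
Variables (S : edge E -> B) (P : vertex E -> B).
Hypothesis tck : is_tck_family S P.
Implicit Types (e f : edge E) (v : vertex E).

Let q e := S e ** star (S e).

Lemma tck_SP e : S e ** P (src e) = S e.
Proof.
case: tck => [[_ Spi] _ SS _]; rewrite -SS cmulA; exact: Spi.
Qed.

Lemma tck_PP v (u : vertex E) : P v ** P u = if v == u then P v else 0.
Proof.
case: tck => [[Pp _] orth _ _]; case: eqVneq => [<-|/orth//].
exact: (Pp v).1.
Qed.

Lemma tck_starP v : star (P v) = P v.
Proof. by case: tck => [[Pp _] _ _ _]; exact: (Pp v).2. Qed.

Lemma range_projection e : is_projection (q e).
Proof.
case: tck => [[_ Spi] _ _ _]; split; last by rewrite /q starM starK.
by rewrite /q cmulA Spi.
Qed.

Lemma tck_gap v : exists c, star c ** c + \sum_(f | rng f == v) q f = P v.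
Proof.
case: tck => [_ _ _ /(_ v)[c cE]]; exists c.
by rewrite -cE subrK.
Qed.

(** Compressing $P_v = c^* c + \sum q_f$ by $1 - P_v$ gives 0 on the left and a sum of positive
    terms on the right. So each $q_f (1 - P_v)$ vanishes. *)
Lemma tck_PS e : P (rng e) ** S e = S e.
Proof.
set v := rng e; have [c cE] := tck_gap v.
have sP := tck_starP v.
have PP : P v ** P v = P v by rewrite tck_PP eqxx.
(* The compression $y \mapsto (1 - P_v) y (1 - P_v)$, written without the unit. *)
pose G (y : B) := y - y ** P v - P v ** (y - y ** P v).
have G0 : G 0 = 0 by rewrite /G cmul0l subr0 cmul0r subr0.
have GD x y : G (x + y) = G x + G y.
  have aux (a b c' d : B) : a + b - (c' + d) = a - c' + (b - d).
    by rewrite opprD addrACA.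
  by rewrite /G !cmulDl !aux cmulDr aux.
have compE (a : B) : star (a - a ** P v) ** (a - a ** P v) = G (star a ** a).
  by rewrite /G starB starM sP cmulBl !cmulBr !cmulA.
have qE f : q f = star (q f) ** q f.
  by have [qq sq] := range_projection f; rewrite sq qq.
pose F (w : B) := w - P v ** w.
have Pproj : is_projection (P v) by split.
have nx f : rng f == v ->
    npos (star (q f - q f ** P v) ** (q f - q f ** P v)).
  move=> _; apply: (@npos_compression _ _ (q f) _ F).
  - exact: range_projection.
  - by rewrite starM starK.
  - by move=> x y; rewrite /F cmulDr opprD addrACA.
  - by move=> x; rewrite /F cmulBr cmulA PP subrr subr0.
  - by move=> x; exact: (projection_norm _ Pproj).2.
  - move=> x; rewrite /F opprB addrC subrK.
    exact: (projection_norm _ Pproj).1.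
  - by move=> x; rewrite compE -qE /G /F !cmulBl !cmulBr !cmulBl !cmulA.
have [|_ /(_ e)] := npos_starM_sum_eq0 nx (v := c - c ** P v).
  rewrite compE (eq_bigr (fun f => G (q f))); last first.
    by move=> f _; rewrite compE -qE.
  by rewrite -(big_morph G GD G0) -GD cE /G PP subrr cmul0r subr0.
move=> /(_ (eqxx _))/eqP; rewrite subr_eq0 => /eqP qP.
have Pq : P v ** q e = q e.
  have [_ sq] := range_projection e.
  by have := congr1 (@star R B) qP; rewrite starM sP !sq => <-.
case: tck => [[_ Spi] _ _ _].
by rewrite -[in LHS](Spi e) cmulA Pq; exact: Spi.
Qed.

(** Edges with different ranges are separated by the $P_v$. Otherwise compress $P_v - q_e = c^* c +
    \sum_{g \ne e} q_g$ by $q_e$: the left side becomes 0, so each $q_g q_e$ vanishes. *)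
Lemma tck_orth e f : e != f -> star (S f) ** S e = 0.
Proof.
move=> ef; have [vv|vv] := eqVneq (rng f) (rng e); last first.
  rewrite -(tck_PS e) -(tck_PS f) starM tck_starP -cmulA (cmulA (P _)).
  by rewrite tck_PP (negbTE vv) cmul0l cmul0r.
have [c cE] := tck_gap (rng e).
have [qq sq] := range_projection e.
pose K (y : B) := q e ** y ** q e.
have K0 : K 0 = 0 by rewrite /K cmul0r cmul0l.
have KD x y : K (x + y) = K x + K y by rewrite /K cmulDr cmulDl.
have compE (a : B) : star (a ** q e) ** (a ** q e) = K (star a ** a).
  by rewrite /K starM sq !cmulA.
have qE g : q g = star (q g) ** q g.
  by have [qq' sq'] := range_projection g; rewrite sq' qq'.
have nx g : (rng g == rng e) && (g != e) ->
    npos (star (q g ** q e) ** (q g ** q e)).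
  move=> _; apply: (@npos_compression _ _ (q g) _ (cmul (q e))).
  - exact: range_projection.
  - by rewrite starM starK.
  - by move=> x y; rewrite cmulDr.
  - by move=> x; rewrite cmulA qq.
  - by move=> x; exact: (projection_norm _ (range_projection e)).1.
  - by move=> x; exact: (projection_norm _ (range_projection e)).2.
  - by move=> x; rewrite compE -qE /K !cmulA.
have [|_ /(_ f)] := npos_starM_sum_eq0 nx (v := c ** q e).
  rewrite compE (eq_bigr (fun g => K (q g))); last first.
    by move=> g _; rewrite compE -qE.
  rewrite -(big_morph K KD K0) -KD.
  have -> : star c ** c + \sum_(i | (rng i == rng e) && (i != e)) q i =
      P (rng e) - q e.
    by rewrite -cE [in RHS](bigD1 e)//= [in RHS]addrCA [RHS]addrC addKr.
  have qP : q e ** P (rng e) = q e.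
    by rewrite /q -cmulA -{1}(tck_starP (rng e)) -starM tck_PS.
  by rewrite /K cmulBr cmulBl qP !qq subrr.
rewrite vv eqxx eq_sym ef => /(_ isT) qfe.
case: tck => [[_ Spi] _ _ _].
have -> : star (S f) ** S e = star (S f) ** (q f ** q e) ** S e.
  rewrite -{1}(Spi e) -{1}(Spi f) starM starM starK /q !cmulA //.
by rewrite qfe cmul0r cmul0l.
Qed.

Lemma tck_SS e f : star (S e) ** S f = if e == f then P (src e) else 0.
Proof.
case: eqVneq => [<-|ef]; first by case: tck.
by apply: tck_orth; rewrite eq_sym.
Qed.

End Families.

Lemma cle_hom (R : realType) (A B : cstarType R) (h : A -> B) (a b : A) :
  star_hom h -> cle a b -> cle (h a) (h b).
Proof.
move=> hh [c cE]; exists (h c).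
by rewrite -(homS hh) -(homM hh) -cE (homB hh).
Qed.

Lemma tck_image (R : realType) (E : digraph) (A B : cstarType R) (h : A -> B)
    (S : edge E -> A) (P : vertex E -> A) :
  star_hom h -> is_tck_family S P -> is_tck_family (h \o S) (h \o P).
Proof.
move=> hh [[Pp Spi] orth SS gap]; split=> /=.
- split=> [v|e]; last by rewrite /is_partial_isometry -(homS hh) -!(homM hh) Spi.
  by split; rewrite -?(homS hh) -?(homM hh) ?(Pp v).1 ?(Pp v).2.
- by move=> v w vw; rewrite -(homM hh) orth// (hom0 hh).
- by move=> e; rewrite -(homS hh) -(homM hh) SS.
- move=> v; have -> : \sum_(e | rng e == v) h (S e) ** star (h (S e)) =
      h (\sum_(e | rng e == v) S e ** star (S e)).
    rewrite (hom_sum hh); apply: eq_bigr => e _.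
    by rewrite (homM hh) (homS hh).
  exact: cle_hom.
Qed.

Lemma ck_image (R : realType) (E : digraph) (A B : cstarType R) (h : A -> B)
    (S : edge E -> A) (P : vertex E -> A) :
  star_hom h -> is_ck_family S P -> is_ck_family (h \o S) (h \o P).
Proof.
move=> hh [tck ck]; split; first exact: tck_image.
move=> v /ck /= ->; rewrite (hom_sum hh).
by apply: eq_bigr => e _; rewrite (homM hh) (homS hh).
Qed.

(** * The representation attached to a family *)

Section Representation.
Variables (R : realType) (E : digraph) (B : cstarType R).
Variables (S : edge E -> B) (P : vertex E -> B).
Hypothesis tck : is_tck_family S P.
Variable z : vertex E -> infpath E.
Hypothesis zP : forall v, infpath_rng (z v) = v.
Local Notation C := (C_infpath R E).
Implicit Types (e f : edge E) (v u : vertex E) (a b x y : C).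

Definition gap v := P v - \sum_(e | rng e == v) S e ** star (S e).

Lemma gap_S v e : gap v ** S e = 0.
Proof.
rewrite /gap cmulBl cmul_suml; have [ve|ve] := eqVneq v (rng e).
  rewrite ve tck_PS// (bigD1 e)//= big1 => [|f /andP[_ fe]].
    by rewrite addr0 -cmulA (tck_SS tck) eqxx tck_SP// subrr.
  by rewrite -cmulA (tck_SS tck) (negbTE fe) cmul0r.
rewrite -(tck_PS tck e) cmulA (tck_PP tck) (negbTE ve) cmul0l sub0r.
rewrite big1 ?oppr0// => f /eqP fv.
rewrite (tck_PS tck) -cmulA (tck_SS tck).
by case: eqVneq => [fe|]; rewrite ?cmul0r//; move: ve; rewrite -fv fe eqxx.
Qed.

Lemma star_gap v : star (gap v) = gap v.
Proof.
rewrite /gap starB (tck_starP tck) star_sum; congr (_ - _).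
by apply: eq_bigr => e _; rewrite starM starK.
Qed.

Lemma starS_gap v e : star (S e) ** gap v = 0.
Proof. by rewrite -star_gap -starM gap_S star0. Qed.

Lemma gap_gap v u : gap v ** gap u = if v == u then gap v else 0.
Proof.
rewrite {2}/gap cmulBr cmul_sumr big1 ?subr0; last first.
  by move=> e _; rewrite cmulA gap_S cmul0l.
rewrite {1}/gap cmulBl (tck_PP tck) cmul_suml; case: eqVneq => [<-|vu].
  congr (_ - _); apply: eq_bigr => e /eqP <-.
  by rewrite -cmulA -(tck_starP tck (rng e)) -starM tck_PS.
rewrite big1 ?subr0// => e /eqP ev.
rewrite -{2}(tck_PS tck e) starM (tck_starP tck) -!cmulA (tck_PP tck) ev.
by rewrite (negbTE vu) !cmul0r.
Qed.

(** A block diagonal element: the scalar [c v] on the gap at [v], and a copy of [X e] carried by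
    [S e] onto its range. *)
Definition block (c : vertex E -> R[i]) (X : edge E -> B) : B :=
  \sum_v c v *: gap v + \sum_e S e ** X e ** star (S e).

Lemma block_S c X e : (forall e, X e ** P (src e) = X e) ->
  block c X ** S e = S e ** X e.
Proof.
move=> XP; rewrite /block cmulDl !cmul_suml big1 ?add0r => [|v _]; last first.
  by rewrite cmulZl gap_S scaler0.
rewrite (bigD1 e)//= big1 ?addr0 => [|f fe].
  by rewrite -cmulA (tck_SS tck) eqxx -cmulA XP.
by rewrite -cmulA (tck_SS tck) (negbTE fe) cmul0r.
Qed.

(** The gaps and the ranges of the [S e] are mutually orthogonal; the hypothesis on [X] absorbs the
    factor $S_e^* S_e = P_{s(e)}$. *)
Lemma blockM c d X Y : (forall e, X e ** P (src e) = X e) ->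
  block c X ** block d Y = block (fun v => c v * d v) (fun e => X e ** Y e).
Proof.
move=> XP; rewrite {2}/block cmulDr !cmul_sumr /block; congr (_ + _).
  apply: eq_bigr => v _; rewrite cmulZr cmulDl !cmul_suml.
  rewrite [X in _ + X]big1 ?addr0 => [|e _]; last first.
    by rewrite -cmulA starS_gap cmul0r.
  rewrite (bigD1 v)//= big1 ?addr0 => [|u uv].
    by rewrite cmulZl gap_gap eqxx scalerA mulrC.
  by rewrite cmulZl gap_gap (negbTE uv) scaler0.
apply: eq_bigr => e _.
by rewrite cmulA cmulA -/(block c X) block_S// !cmulA.
Qed.

Lemma star_block c X : star (block c X) =
  block (fun v => (c v)^*) (fun e => star (X e)).
Proof.
rewrite /block starD !star_sum; congr (_ + _); apply: eq_bigr.
  by move=> v _; rewrite starZ star_gap.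
by move=> e _; rewrite !starM starK cmulA.
Qed.

Lemma block_linear (k : R[i]) c d X Y : k *: block c X + block d Y =
  block (fun v => k * c v + d v) (fun e => k *: X e + Y e).
Proof.
rewrite /block scalerDr addrACA !scaler_sumr -!big_split/=.
congr (_ + _); apply: eq_bigr.
  by move=> v _; rewrite scalerA -scalerDl.
by move=> e _; rewrite cmulDr cmulDl cmulZr cmulZl.
Qed.

Lemma block_cvg c (u : nat -> edge E -> B) (X : edge E -> B) :
  (forall e, u ^~ e @ \oo --> X e) ->
  (fun n => block c (u n)) @ \oo --> block c X.
Proof.
move=> uX; apply: cvgD; first exact: cvg_cst.
apply: (@cvg_big _ _ +%R 0 xpredT _ _ _ (index_enum (edge E))
  (fun e n => S e ** u n e ** star (S e))); first exact: add_continuous.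
move=> e _; apply: (continuous_cvg _ (@cmulr_cts _ _ (star (S e)) _)).
exact: (continuous_cvg _ (@cmull_cts _ _ (S e) _) (uX e)).
Qed.

Fixpoint approx_rep n a : B :=
  if n is m.+1 then block (fun v => ev a (z v)) (fun e => approx_rep m (pull e a))
  else \sum_v ev a (z v) *: P v.

Lemma approx_rep_linear n : linear (approx_rep n).
Proof.
elim: n => [|n IH] k a b /=.
  rewrite scaler_sumr -big_split/=; apply: eq_bigr => v _.
  by rewrite evD evZ scalerDl scalerA.
rewrite block_linear; congr block; apply/funext => e.
by rewrite pull_linear IH.
Qed.

(** This precedes multiplicativity, whose proof takes from it the condition $X_e P_{s(e)} = X_e$ of
    [blockM]. *)
Lemma approx_rep_chiv n v : approx_rep n (chiv R v) = P v.
Proof.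
have r0 m : approx_rep m 0 = 0.
  have := approx_rep_linear m 1 0 0; rewrite !scale1r addr0 => rm.
  by apply: (addIr (approx_rep m 0)); rewrite add0r -rm.
elim: n v => [|n IH] v /=.
  rewrite (bigD1 v)//= big1 ?addr0 => [|u uv]; rewrite ev_chiv zP.
    by rewrite eqxx scale1r.
  by rewrite (negbTE uv) scale0r.
rewrite /block (bigD1 v)//= big1 ?addr0 => [|u uv]; rewrite ev_chiv zP;
  last by rewrite (negbTE uv) scale0r.
rewrite eqxx scale1r /gap; apply/eqP; rewrite addrAC subr_eq; apply/eqP.
congr (_ + _); rewrite [RHS]big_mkcond; apply: eq_bigr => e _.
rewrite pull_chiv; case: ifP => _; last by rewrite r0 cmul0r cmul0l.
by rewrite IH tck_SP.
Qed.

Lemma approx_rep_star_hom n : star_hom (approx_rep n).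
Proof.
split; first exact: approx_rep_linear.
- elim: n => [|n IH] a b /=; last first.
    rewrite blockM => [|e]; last first.
      by rewrite -(approx_rep_chiv n) -IH cmul_chivC chiv_pull.
    by congr block; apply/funext => e; rewrite pullM IH.
  rewrite cmul_suml; apply: eq_bigr => v _.
  rewrite cmulZl cmul_sumr (bigD1 v)//= big1 ?addr0 => [|u uv].
    by rewrite cmulZr (tck_PP tck) eqxx scalerA evM.
  by rewrite cmulZr (tck_PP tck) eq_sym (negbTE uv) scaler0.
elim: n => [|n IH] a /=; last first.
  by rewrite star_block; congr block; apply/funext => e; rewrite pullS IH.
rewrite star_sum; apply: eq_bigr => v _.
by rewrite starZ (tck_starP tck) evS.
Qed.

(** The functions with convergent iteration satisfy the closure conditions of [C_infpath_ind]; they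
    form a closed set because every [approx_rep n] is a contraction. *)
Lemma approx_rep_cvg a : cvgn (approx_rep ^~ a).
Proof.
have rhom := approx_rep_star_hom.
apply: (@C_infpath_ind _ _ (fun a => cvgn (approx_rep ^~ a))).
- move=> {}a /dist_closure Da; apply/cauchy_cvgP/cauchyP => d d0.
  have d40 : 0 < d / 3 by rewrite divr_gt0.
  have [b /cvg_ex[l bl] ab] := Da _ d40.
  move/cvgrPdist_lt : bl => /(_ _ d40)[N _ bN].
  exists l; exists N => // n /= /bN ln; rewrite -ball_normE /=.
  have -> : d = d / 3 + (d / 3 + d / 3) by field.
  rewrite -(subrKA (approx_rep n b)); apply: le_lt_trans (ler_normD _ _) _.
  rewrite ltrD//; apply: (@lt_trans _ _ (d / 3)); last by rewrite ltrDl.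
  rewrite -(homB (rhom n)); apply: le_lt_trans (hom_norm_le (rhom n) _) _.
  by rewrite distrC.
- apply/cvg_ex; exists 0; rewrite (_ : approx_rep ^~ 0 = cst 0).
    exact: cvg_cst.
  by apply/funext => n; rewrite (hom0 (rhom n)).
- move=> k {}a b /cvg_ex[l al] /cvg_ex[m bm]; apply/cvg_ex; exists (k *: l + m).
  rewrite (_ : approx_rep ^~ _ = (fun n => k *: approx_rep n a + approx_rep n b)).
    by apply: cvgD => //; exact: cvgZl_tmp.
  by apply/funext => n; rewrite approx_rep_linear.
- move=> v; apply/cvg_ex; exists (P v).
  rewrite (_ : approx_rep ^~ _ = cst (P v)); first exact: cvg_cst.
  by apply/funext => n; rewrite approx_rep_chiv.
move=> e {}a /cvg_ex[l al]; apply/cvg_ex.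
(* One step of the recursion strips the edge [e]: of the pullbacks of $\chi_{Z(e)} \cdot a$ only the
   one along [e] survives, and it is $\chi_{Z(s(e))} a$. *)
exists (block (fun v => ev (X_ract (chie R e) a) (z v))
  (fun f => if f == e then P (src e) ** l else 0)).
rewrite -(cvg_shiftS (approx_rep ^~ _)) /=; apply: block_cvg => f.
under eq_fun do rewrite pull_ract_chie.
case: eqP => _; last first.
  under eq_fun do rewrite (hom0 (rhom _)).
  exact: cvg_cst.
under eq_fun do rewrite (homM (rhom _)) approx_rep_chiv.
exact: (continuous_cvg _ (@cmull_cts _ _ _ l) al).
Qed.

Definition rep a : B := lim (approx_rep ^~ a @ \oo).

Lemma approx_rep_lim a : approx_rep ^~ a @ \oo --> rep a.
Proof. exact: approx_rep_cvg. Qed.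

Lemma rep_eq a l : approx_rep ^~ a @ \oo --> l -> rep a = l.
Proof. by move=> al; apply: cvg_lim => //; exact: norm_hausdorff. Qed.

Lemma rep_star_hom : star_hom rep.
Proof.
have rhom := approx_rep_star_hom; split.
- move=> k a b; apply: rep_eq; under eq_fun do rewrite approx_rep_linear.
  by apply: cvgD; [apply: cvgZl_tmp|]; exact: approx_rep_lim.
- move=> a b; apply: rep_eq; under eq_fun do rewrite (homM (rhom _)).
  by apply: cmul_cvg; exact: approx_rep_lim.
- move=> a; apply: rep_eq; under eq_fun do rewrite (homS (rhom _)).
  exact: (cvg_comp _ _ (@approx_rep_lim a) (@star_cts R B (rep a))).
Qed.

Lemma rep_chiv v : rep (chiv R v) = P v.
Proof.
apply: rep_eq; under eq_fun do rewrite approx_rep_chiv; exact: cvg_cst.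
Qed.

(** The recursion in the limit. When the gaps vanish, this is the Cuntz-Pimsner relation. *)
Lemma rep_block a :
  rep a = block (fun v => ev a (z v)) (fun e => rep (pull e a)).
Proof.
apply: rep_eq; rewrite -(cvg_shiftS (approx_rep ^~ _)) /=.
by apply: block_cvg => e; exact: approx_rep_lim.
Qed.

Lemma rep_pull_src e a : rep (pull e a) ** P (src e) = rep (pull e a).
Proof. by rewrite -rep_chiv -(homM rep_star_hom) cmul_chivC chiv_pull. Qed.

Lemma rep_S a e : rep a ** S e = S e ** rep (pull e a).
Proof. by rewrite rep_block block_S// => f; exact: rep_pull_src. Qed.

Definition rep_mod x : B := \sum_e S e ** rep (pull e x).

Lemma rep_mod_chie e : rep_mod (chie R e) = S e.
Proof.
rewrite /rep_mod (bigD1 e)//= big1 ?addr0 => [|f fe]; rewrite pull_chie.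
  by rewrite eqxx rep_chiv tck_SP.
by rewrite (negbTE fe) (hom0 rep_star_hom) cmul0r.
Qed.

Lemma rep_representation :
  @is_representation R C (X_infpath R E) B rep_mod rep.
Proof.
have rhom := rep_star_hom; split=> //.
- move=> k x y; rewrite /rep_mod scaler_sumr -big_split/=.
  apply: eq_bigr => e _.
  by rewrite pull_linear (homD rhom) (homZ rhom) cmulDr cmulZr.
- move=> a x b; rewrite /rep_mod cmul_sumr cmul_suml; apply: eq_bigr => e _.
  rewrite cmulA rep_S -!cmulA -!(homM rhom); congr (_ ** rep _).
  by rewrite [LHS]pull_lact pull_ract.
- move=> x y; rewrite [in LHS]/hip /= X_ip_pull (hom_sum rhom) /rep_mod star_sum.
  rewrite cmul_suml; apply: eq_bigr => e _; rewrite cmul_sumr (bigD1 e)//=.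
  rewrite big1 ?addr0 => [|f fe]; rewrite starM -cmulA (cmulA (star (S e))).
    rewrite (tck_SS tck) eqxx -rep_chiv -!(homM rhom) chiv_pull.
    by rewrite -(homS rhom) -(homM rhom).
  by rewrite (tck_SS tck) eq_sym (negbTE fe) cmul0l cmul0r.
Qed.

End Representation.

(** * Representations of the path bimodule *)

Section Operators.
Variables (R : realType) (A B : cstarType R) (X : hilbert_bimodule A).
Implicit Types (x y z : X).

Lemma hip_ractl x y (a : A) : hip (ract x a) y = star a ** hip x y.
Proof. by rewrite -star_hip hip_ract starM star_hip. Qed.

Lemma hipDr x y z : hip x (y + z) = hip x y + hip x z.
Proof. by have := hip_linearr x 1 y z; rewrite !scale1r. Qed.

Lemma hipDl x y z : hip (x + y) z = hip x z + hip y z.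
Proof. by rewrite -star_hip hipDr starD !star_hip. Qed.

Lemma hip0r x : hip x 0 = 0.
Proof. by apply: (addIr (hip x 0)); rewrite -hipDr !add0r. Qed.

Lemma hip0l x : hip 0 x = 0.
Proof. by rewrite -star_hip hip0r star0. Qed.

Lemma theta_adjoint x y : is_adjoint (theta x y) (theta y x).
Proof.
by move=> z w; rewrite /theta hip_ractl hip_ract star_hip.
Qed.

Variables (I : Type) (x y : I -> X).

Lemma finite_rank_compact (r : seq I) :
  compact_op (fun z => \sum_(i <- r) theta (x i) (y i) z).
Proof.
split.
  exists (fun z => \sum_(i <- r) theta (y i) (x i) z) => z w.
  rewrite (big_morph (fun t => hip t w) (fun a b => hipDl a b w) (hip0l w)).
  rewrite (big_morph (hip z) (hipDr z) (hip0r z)).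
  by apply: eq_bigr => i _; exact: theta_adjoint.
move=> e e0; exists (fun z => \sum_(i <- r) theta (x i) (y i) z); split.
  exists (size r), (fun=> 1), (fun i => x (tnth (in_tuple r) i)),
    (fun i => y (tnth (in_tuple r) i)).
  apply/funext => z; rewrite big_tnth.
  by apply: eq_bigr => i _; rewrite scale1r.
move=> z; rewrite subrr {1}/hb_norm /bimod_norm hip0r normr0 sqrtC0.
by apply: mulr_ge0; [exact: ltW|rewrite /hb_norm /bimod_norm sqrtC_ge0].
Qed.

(** Additivity of [rho] is given on compact operators only, so the induction runs through
    finite-rank sums; the empty sum is handled by cancellation. *)
Lemma rep1_finite_rank (psi : X -> B) (rho : (X -> X) -> B) (r : seq I) :
  is_rep1 psi rho -> rho (fun z => \sum_(i <- r) theta (x i) (y i) z) =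
  \sum_(i <- r) psi (x i) ** star (psi (y i)).
Proof.
case=> rl _ _ rt.
pose T (r : seq I) := fun z => \sum_(i <- r) theta (x i) (y i) z.
have rD (s t u : seq I) : T u = (fun z => 1 *: T s z + T t z) ->
    rho (T u) = rho (T s) + rho (T t).
  move=> ->; rewrite -[rho (T s)]scale1r; apply: rl; exact: finite_rank_compact.
elim: r => [|i r IH].
  rewrite big_nil -/(T [::]); apply: (addIr (rho (T [::]))).
  rewrite add0r -(rD _ _ [::])//.
  by apply/funext => z; rewrite scale1r /T !big_nil addr0.
rewrite big_cons -IH -/(T (i :: r)) (rD [:: i] r); last first.
  by apply/funext => z; rewrite scale1r /T big_cons big_seq1.
congr (_ + _); rewrite -rt; congr rho.
by apply/funext => z; rewrite /T big_seq1.
Qed.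

End Operators.

(** * Composition, ranges and uniqueness of homomorphisms *)

Lemma star_hom_comp (R : realType) (A B D : cstarType R) (f : A -> B)
    (g : B -> D) : star_hom f -> star_hom g -> star_hom (g \o f).
Proof.
move=> hf hg; split=> [c a b|a b|a] /=.
- by rewrite (homD hf) (homZ hf) (homD hg) (homZ hg).
- by rewrite (homM hf) (homM hg).
- by rewrite (homS hf) (homS hg).
Qed.

Lemma star_hom_id (R : realType) (A : cstarType R) : star_hom (@id A).
Proof. by []. Qed.

Lemma range_subalgebra (R : realType) (A B : cstarType R) (f : A -> B) :
  star_hom f -> star_subalgebra (range f).
Proof.
move=> hf; split.
- by exists 0 => //; exact: hom0.
- move=> c _ _ [a _ <-] [b _ <-]; exists (c *: a + b) => //.
  by rewrite (homD hf) (homZ hf).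
- by move=> _ _ [a _ <-] [b _ <-]; exists (a ** b); rewrite // (homM hf).
- by move=> _ [a _ <-]; exists (star a); rewrite // (homS hf).
Qed.

Section Universal.
Variables (R : realType) (E : digraph) (A B : cstarType R).
Variables (s : edge E -> A) (p : vertex E -> A) (f g : A -> B).

Lemma TCstar_ext : is_TCstar s p -> star_hom f -> star_hom g ->
  (forall e, f (s e) = g (s e)) -> (forall v, f (p v) = g (p v)) ->
  forall a, f a = g a.
Proof.
move=> [tck univ] hf hg fgs fgp a.
have [h [_ huniq]] := univ _ _ _ (tck_image hf tck).
have -> : f = h by symmetry; apply: huniq; split.
by congr (_ a); apply: huniq; split=> // [e|v] /=; rewrite ?fgs ?fgp.
Qed.

Lemma Cstar_ext : is_Cstar s p -> star_hom f -> star_hom g ->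
  (forall e, f (s e) = g (s e)) -> (forall v, f (p v) = g (p v)) ->
  forall a, f a = g a.
Proof.
move=> [ck univ] hf hg fgs fgp a.
have [h [_ huniq]] := univ _ _ _ (ck_image hf ck).
have -> : f = h by symmetry; apply: huniq; split.
by congr (_ a); apply: huniq; split=> // [e|v] /=; rewrite ?fgs ?fgp.
Qed.

End Universal.

(** * The Toeplitz-Cuntz-Krieger family of a representation *)

Section PathRepresentation.
Variables (R : realType) (E : digraph) (B : cstarType R).
Local Notation C := (C_infpath R E).
Variables (psi : X_infpath R E -> B) (pi : C -> B).
Hypothesis rep : is_representation psi pi.
Implicit Types (e f : edge E) (v u : vertex E) (a b x : C).

Let S e := psi (chie R e).
Let P v := pi (chiv R v).

Lemma representation_star_hom : star_hom pi.
Proof. by case: rep. Qed.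

Lemma psi_linear : linear psi.
Proof. by case: rep. Qed.

Let phom := representation_star_hom.

Lemma psi_ip x y : star (psi x) ** psi y = pi (X_ip x y).
Proof. by case: rep => _ _ _ /(_ x y). Qed.

Lemma psi_lact_ract a x b :
  psi (X_lact a (X_ract x b)) = pi a ** psi x ** pi b.
Proof. by case: rep => _ _ /(_ a x b). Qed.

(** The representation axiom treats both actions at once; the unit $\sum_v \chi_{Z(v)}$ of
    $C(E^\infty)$ separates them. *)
Lemma psi_unit x (one := \sum_v chiv R v) :
  pi one ** psi x = psi x /\ psi x ** pi one = psi x.
Proof.
have one1 : pi one ** pi one = pi one by rewrite -(homM phom) sum_chiv_mul.
have E1 : psi x = pi one ** psi x ** pi one.
  rewrite -psi_lact_ract; congr psi; apply: Cext => z.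
  by rewrite ev_lact ev_ract !ev_sum_chiv mul1r mulr1.
split; first by rewrite [in LHS]E1 !cmulA one1.
by rewrite [in LHS]E1 -[LHS]cmulA one1.
Qed.

Lemma psi_lact a x : psi (X_lact a x) = pi a ** psi x.
Proof.
have [_ x1] := psi_unit x.
rewrite -[in RHS]x1 cmulA -psi_lact_ract; congr psi; apply: Cext => z.
by rewrite !ev_lact ev_ract ev_sum_chiv mulr1.
Qed.

Lemma psi_ract x b : psi (X_ract x b) = psi x ** pi b.
Proof.
have [x1 _] := psi_unit x.
rewrite -[in RHS]x1 -psi_lact_ract; congr psi; apply: Cext => z.
by rewrite !ev_lact ev_sum_chiv mul1r.
Qed.

Lemma psi_sum (I : Type) (r : seq I) (F : I -> C) :
  psi (\sum_(i <- r) F i) = \sum_(i <- r) psi (F i).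
Proof.
have pD x y : psi (x + y) = psi x + psi y.
  by have := psi_linear 1 x y; rewrite !scale1r.
apply: (big_morph psi pD).
by apply: (addIr (psi 0)); rewrite -pD !add0r.
Qed.

Lemma representation_tck : is_tck_family S P.
Proof.
have PP v u : P v ** P u = if v == u then P v else 0.
  rewrite /P -(homM phom) chiv_orthogonal.
  by case: ifP => //; rewrite (hom0 phom).
have sP v : star (P v) = P v by rewrite /P -(homS phom) star_chiv.
have SS e f : star (S e) ** S f = if e == f then P (src e) else 0.
  by rewrite /S psi_ip X_ip_chie; case: ifP => //; rewrite (hom0 phom).
have SP e : S e ** P (src e) = S e.
  by rewrite -psi_ract /S; congr psi; exact: chie_ract_src.
have PS e : P (rng e) ** S e = S e.
  by rewrite -psi_lact /S; congr psi; exact: lact_chie_rng.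
split.
- split=> [v|e]; first by split; rewrite ?PP ?eqxx.
  by rewrite /is_partial_isometry -cmulA SS eqxx SP.
- by move=> v u vu; rewrite PP (negbTE vu).
- by move=> e; rewrite SS eqxx.
(* The gap $P_v - Q$ is a projection, so it is its own witness of positivity. *)
move=> v; set Q := \sum_(e | _) _; exists (P v - Q).
have sQ : star Q = Q.
  by rewrite star_sum; apply: eq_bigr => e _; rewrite starM starK.
have PQ : P v ** Q = Q.
  by rewrite cmul_sumr; apply: eq_bigr => e /eqP <-; rewrite cmulA PS.
have QP : Q ** P v = Q by rewrite -sQ -(sP v) -starM PQ.
have QQ : Q ** Q = Q.
  rewrite {1}/Q cmul_suml; apply: eq_bigr => e ev.
  rewrite cmul_sumr (bigD1 e)//= big1 ?addr0 => [|f /andP[_ fe]].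
    by rewrite cmulA -(cmulA (S e)) SS eqxx SP.
  by rewrite cmulA -(cmulA (S e)) SS eq_sym (negbTE fe) cmul0r cmul0l.
by rewrite starB sP sQ cmulBl !cmulBr PP eqxx PQ QP QQ subrr subr0.
Qed.

Lemma psi_decomp x : psi x = \sum_e S e ** pi (pull e x).
Proof.
rewrite [in LHS](chie_decomp x) psi_sum.
by apply: eq_bigr => e _; exact: psi_ract.
Qed.

Lemma lact_finite_rank a : @lact R C (X_infpath R E) a =
  fun z => \sum_e
    theta (X_ract (chie R e) (pull e a) : X_infpath R E) (chie R e) z.
Proof. by apply/funext => z; exact: lact_theta. Qed.

Lemma lact_compact a : compact_op (@lact R C (X_infpath R E) a).
Proof. by rewrite lact_finite_rank; exact: finite_rank_compact. Qed.

Lemma rep1_lact (rho : (X_infpath R E -> X_infpath R E) -> B) a :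
  is_rep1 psi rho -> rho (@lact R C (X_infpath R E) a) =
  \sum_e S e ** pi (pull e a) ** star (S e).
Proof.
move=> hrho; rewrite lact_finite_rank (rep1_finite_rank _ _ _ hrho).
by apply: eq_bigr => e _; rewrite psi_ract.
Qed.

End PathRepresentation.

(** * Paths into every vertex, and the theorem *)

Lemma infpath_exists (E : digraph) : no_sources E ->
  exists z : vertex E -> infpath E, forall v, infpath_rng (z v) = v.
Proof.
move=> /choice[g gP]; pose back v := src (g v).
have zP v i : src (g (iter i back v)) = rng (g (iter i.+1 back v)).
  by rewrite gP.
by exists (fun v => InfPath (zP v)) => v; exact: gP.
Qed.

Theorem proposition7p1 (R : realType) (E : digraph)
  (* T(X(E^oo)), with universal representation (psi, pi) and (psi, pi)^(1) *)
  (TX : cstarType R) (psi : X_infpath R E -> TX) (pi : C_infpath R E -> TX)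
  (hTX : is_toeplitz psi pi)
  (rho : (X_infpath R E -> X_infpath R E) -> TX) (hrho : is_rep1 psi rho)
  (* O(X(E^oo)), with quotient map q *)
  (OX : cstarType R) (q : TX -> OX) (hOX : is_cuntz_pimsner pi rho q)
  (* TC*(E), with universal family (ts, tp) *)
  (TCE : cstarType R) (ts : edge E -> TCE) (tp : vertex E -> TCE)
  (hTCE : is_TCstar ts tp)
  (* C*(E), with universal family (cs, cp), and its quotient map from TC*(E) *)
  (CE : cstarType R) (cs : edge E -> CE) (cp : vertex E -> CE)
  (hCE : is_Cstar cs cp)
  (k : TCE -> CE) (hk : is_family_hom ts tp cs cp k)
  (* gauge actions *)
  (gTX : R[i] -> TX -> TX) (hgTX : is_toeplitz_gauge psi pi gTX)
  (gOX : R[i] -> OX -> OX)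
  (hgOX : forall z, `|z| = 1 -> forall t, gOX z (q t) = q (gTX z t))
  (gTCE : R[i] -> TCE -> TCE) (hgTCE : is_graph_gauge ts tp gTCE)
  (gCE : R[i] -> CE -> CE) (hgCE : is_graph_gauge cs cp gCE) :
  let S e := psi (chi R (cylinders_edge e)) in
  let P v := pi (chi R (cylinders_vertex v)) in
  is_tck_family S P /\
  exists piSP : TCE -> TX,
    [/\ is_family_hom ts tp S P piSP,
        no_sources E -> injective piSP,
        (forall z, `|z| = 1 -> forall t, piSP (gTCE z t) = gTX z (piSP t))
      & exists phi : CE -> OX,
          [/\ star_hom phi,
              forall t, q (piSP t) = phi (k t),
              forall y, exists x, phi x = y,
              no_sources E -> injective phi
            & forall z, `|z| = 1 -> forall t, phi (gCE z t) = gOX z (phi t)]].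
Proof.
move=> S P; have [hrep hgen huniv] := hTX.
have phom := representation_star_hom hrep.
have tckSP : is_tck_family S P by exact: representation_tck hrep.
split=> //; have [piSP [hpiSP _]] := hTCE.2 _ _ _ tckSP.
have [piSP_hom piSPs piSPp] := hpiSP.
have [qhom qsurj qker] := hOX.
(* The Cuntz-Pimsner relation, valid for every [a] since the left action is compact. At $a =
   \chi_{Z(v)}$ it gives the Cuntz-Krieger relation. *)
have q_pi a : q (pi a) = \sum_e q (S e) ** q (pi (pull e a)) ** star (q (S e)).
  have : [set t | q t = 0] (pi a - rho (@lact R _ (X_infpath R E) a)).
    rewrite qker => I hI; apply; exists a => //; exact: lact_compact.
  move=> /=; rewrite (homB qhom) => /eqP; rewrite subr_eq0 => /eqP ->.
  rewrite (rep1_lact hrep _ hrho) (hom_sum qhom); apply: eq_bigr => e _.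
  by rewrite !(homM qhom) (homS qhom).
have tckq := tck_image qhom tckSP.
have ckq : is_ck_family (q \o S) (q \o P).
  split=> // v _; rewrite /= q_pi [RHS]big_mkcond; apply: eq_bigr => e _.
  rewrite pull_chiv; case: ifP => _.
    by congr (_ ** _); exact: (tck_SP tckq).
  by rewrite (hom0 phom) (hom0 qhom) cmul0r cmul0l.
have [phi [[phi_hom phis phip] _]] := hCE.2 _ _ _ ckq.
have [khom ks kp] := hk.
have phik t : q (piSP t) = phi (k t).
  apply: (@TCstar_ext _ _ _ _ _ _ (q \o piSP) (phi \o k) hTCE _ _ _ _ t).
  - exact: star_hom_comp.
  - exact: star_hom_comp.
  - by move=> e /=; rewrite piSPs ks phis.
  - by move=> v /=; rewrite piSPp kp phip.
exists piSP; split=> //.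
- move=> /infpath_exists[z zP]; have tckt := hTCE.1.
  (* The representation built from the universal family ([ts], [tp]) extends to [h] on [TX], and [h]
     after [piSP] fixes the generators. *)
  have [h [[hhom hpsi hpi] _]] := huniv _ _ _ (rep_representation tckt zP).
  suff : cancel piSP h by exact: can_inj.
  move=> t; apply: (@TCstar_ext _ _ _ _ _ _ (h \o piSP) id hTCE _ _ _ _ t).
  - exact: star_hom_comp.
  - exact: star_hom_id.
  - by move=> e /=; rewrite piSPs hpsi (rep_mod_chie tckt zP).
  - by move=> v /=; rewrite piSPp hpi (rep_chiv tckt zP).
- move=> c c1 t; have [gThom gTs gTp] := hgTCE c c1.
  have [gXhom gXpsi gXpi] := hgTX c c1.
  apply: (@TCstar_ext _ _ _ _ _ _ (piSP \o gTCE c) (gTX c \o piSP)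
    hTCE _ _ _ _ t).
  - exact: star_hom_comp.
  - exact: star_hom_comp.
  - by move=> e /=; rewrite gTs piSPs (homZ piSP_hom) piSPs gXpsi.
  - by move=> v /=; rewrite gTp piSPp gXpi.
exists phi; split=> //.
- move=> y; have [t <-] := qsurj y.
  (* Since [range phi] is closed, its preimage under [q] is a closed star-subalgebra; it remains to
     find the generators of [TX] in it. *)
  suff : [set t | range phi (q t)] t by move=> [x _ <-]; exists x.
  have [r0 rl rm rs] := range_subalgebra phi_hom.
  have rsum (I : Type) (s : seq I) (F : I -> OX) :
      (forall i, range phi (F i)) -> range phi (\sum_(i <- s) F i).
    move=> rF; elim/big_rec: _ => // i b _ rb.
    by rewrite -[F i]scale1r; exact: rl.
  have rS e : range phi (q (S e)) by exists (cs e).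
  have cq : closed (range phi) := range_closed phi_hom.
  have rpi a : range phi (q (pi a)).
    move: a; apply: C_infpath_ind.
    + apply: (@preimage_closed _ _ (q \o pi)) cq => a _.
      exact: (hom_cts (star_hom_comp phom qhom)).
    + by rewrite (hom0 phom) (hom0 qhom).
    + move=> c a b ra rb.
      by rewrite (homD phom) (homZ phom) (homD qhom) (homZ qhom); exact: rl.
    + by move=> v; exists (cp v).
    (* By [q_pi], only the edge [e] contributes, and its term is a product of elements already known
       to lie in the range. *)
    + move=> e a ra; rewrite q_pi; apply: rsum => f.
      rewrite pull_ract_chie; case: ifP => _; last first.
        by rewrite (hom0 phom) (hom0 qhom) cmul0r cmul0l.
      rewrite (homM phom) (homM qhom); apply: (rm); last exact: rs.
      by apply: (rm) => //; apply: (rm) => //; exists (cp (src e)).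
  rewrite (hgen [set t | range phi (q t)])//.
  + by apply: preimage_closed cq => a _; exact: (hom_cts qhom).
  + split=> /=.
    * by rewrite (hom0 qhom).
    * by move=> c a b ra rb; rewrite (homD qhom) (homZ qhom); exact: rl.
    * by move=> a b ra rb; rewrite (homM qhom); exact: rm.
    * by move=> a ra; rewrite (homS qhom); exact: rs.
  + move=> _ [[x _ <-]|[a _ <-]] /=; last exact: rpi.
    rewrite (psi_decomp hrep) (hom_sum qhom); apply: rsum => e.
    by rewrite (homM qhom); apply: (rm); [exact: rS|exact: rpi].
- move=> nsE; have [z zP] := infpath_exists nsE.
  have [tckc ckc] := hCE.1.
  have gap0 v : gap cs cp v = 0 by rewrite /gap (ckc _ (nsE v)) subrr.
  have [h [[hhom hpsi hpi] _]] := huniv _ _ _ (rep_representation tckc zP).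
  (* The kernel of [h] is a closed ideal containing the Cuntz-Pimsner generators, because
     [rep_block] has no gap terms here. *)
  have hker t : q t = 0 -> h t = 0.
    move=> qt; have : [set t | q t = 0] t by [].
    rewrite qker => /(_ [set t | h t = 0]); apply.
      split=> /=.
      - by apply: closed_eqfun; [exact: hom_cts|exact: cst_continuous].
      - exact: hom0.
      - move=> c a b ha hb.
        by rewrite (homD hhom) (homZ hhom) ha hb scaler0 addr0.
      - by move=> a b ha; rewrite !(homM hhom) ha cmul0l cmul0r.
    move=> _ [a _ <-] /=.
    rewrite (rep1_lact hrep _ hrho) (homB hhom) (hom_sum hhom) hpi.
    rewrite (rep_block tckc zP) /block big1 ?add0r => [|v _]; last first.
      by rewrite gap0 scaler0.
    apply/eqP; rewrite subr_eq0; apply/eqP; apply: eq_bigr => e _.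
    by rewrite !(homM hhom) (homS hhom) !hpsi hpi (rep_mod_chie tckc zP).
  have hq s t : q s = q t -> h s = h t.
    move=> st; apply/eqP; rewrite -subr_eq0 -(homB hhom); apply/eqP; apply: hker.
    by rewrite (homB qhom) st subrr.
  (* An arbitrary section [l] of [q]: by [hq] the composite [h \o l] respects the operations
     although [l] need not. *)
  have [l lK] := choice qsurj.
  have h'hom : star_hom (h \o l).
    split=> [c a b|a b|a] /=.
    - rewrite -(homZ hhom) -(homD hhom); apply: hq.
      by rewrite (homD qhom) (homZ qhom) !lK.
    - by rewrite -(homM hhom); apply: hq; rewrite (homM qhom) !lK.
    - by rewrite -(homS hhom); apply: hq; rewrite (homS qhom) !lK.
  suff : cancel phi (h \o l) by exact: can_inj.
  move=> x; apply: (@Cstar_ext _ _ _ _ _ _ ((h \o l) \o phi) id hCE _ _ _ _ x).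
  - exact: star_hom_comp.
  - exact: star_hom_id.
  - move=> e /=; rewrite phis (hq _ (S e)) ?lK//.
    by rewrite hpsi (rep_mod_chie tckc zP).
  - move=> v /=; rewrite phip (hq _ (P v)) ?lK//.
    by rewrite hpi (rep_chiv tckc zP).
move=> c c1 x; have [gChom gCs gCp] := hgCE c c1.
have [gXhom gXpsi gXpi] := hgTX c c1.
(* The action on [OX] is specified only through [q], so its homomorphism laws are checked on
   lifts. *)
have gOhom : star_hom (gOX c).
  split=> [d a b|a b|a].
  - have [a' <-] := qsurj a; have [b' <-] := qsurj b.
    by rewrite -(homZ qhom) -(homD qhom) !hgOX// (homD gXhom) (homZ gXhom)
      (homD qhom) (homZ qhom).
  - have [a' <-] := qsurj a; have [b' <-] := qsurj b.
    by rewrite -(homM qhom) !hgOX// (homM gXhom) (homM qhom).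
  - have [a' <-] := qsurj a.
    by rewrite -(homS qhom) !hgOX// (homS gXhom) (homS qhom).
apply: (@Cstar_ext _ _ _ _ _ _ (phi \o gCE c) (gOX c \o phi) hCE _ _ _ _ x).
- exact: star_hom_comp.
- exact: star_hom_comp.
- by move=> e /=; rewrite gCs (homZ phi_hom) phis hgOX// gXpsi (homZ qhom).
- by move=> v /=; rewrite gCp phip hgOX// gXpi.
Qed.
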